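(* A partial function $f:\mathbb{R}\to\mathbb{R}$ is infinite time computable if and only if the function $1^\frown f$, defined by $(1^\frown f)(x)=1^\frown f(x)$ (with the same domain as $f$), is one-tape computable.
   Context: $\mathbb{R}=2^\omega$; for $a\in\mathbb{R}$, $1^\frown a=\langle 1a_0a_1a_2\cdots\rangle$. An infinite time Turing machine (ITTM) has three tapes (input, scratch, output) of cells indexed by $\omega$ with values in $\{0,1\}$, one head scanning a column of all three tapes, and a program with finitely many states including start, halt and a limit state. Successor steps are as for ordinary Turing machines (moving left from the leftmost cell leaves the head in place); at limit stages the head returns to the leftmost cell, the state becomes the limit state, and each cell takes the $\limsup$ of its earlier values. On input $a$, $a$ is on the input tape and other tapes are $0$; upon halting the output is the output tape. $f$ is (infinite time) computable if some program on input $a$ halts iff $a\in\mathrm{dom}(f)$, with output $f(a)$. A one-tape ITTM is the same with a single tape that initially holds the input and whose whole contents are the output upon halting; one-tape computable is defined analogously. *)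

(* Defs.v *)
From mathcomp Require Import all_boot.
Unset Printing Implicit Defensive.

(* Reals are elements of Cantor space 2^omega. *)
Definition real := nat -> bool.

Definition cons1 (a : real) : real :=
  fun n => match n with 0 => true | m.+1 => a m end.

(* A program with k tapes: finitely many states 'I_nst, a (total) transition
   function reading the column of k symbols under the head and returning the
   k symbols to write, the move (true = right, false = left) and the new
   state; plus distinguished start, halt and limit states. *)
Record machine (k : nat) := Machine {
  nst : nat;
  delta : 'I_nst -> {ffun 'I_k -> bool} -> {ffun 'I_k -> bool} * bool * 'I_nst;
  q_start : 'I_nst;
  q_halt : 'I_nst;
  q_lim : 'I_nst }.
Arguments nst {k}. Arguments delta {k}. Arguments q_start {k}.
Arguments q_halt {k}. Arguments q_lim {k}.

Record config (k n : nat) := Config {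
  st : 'I_n;
  head : nat;
  tape : 'I_k -> nat -> bool }.
Arguments Config {k n}. Arguments st {k n}. Arguments head {k n}.
Arguments tape {k n}.

(* Successor step; moving left from cell 0 leaves the head in place (n.-1). *)
Definition step {k} (M : machine k) (c : config k (nst M)) : config k (nst M) :=
  let col := [ffun t => tape c t (head c)] in
  match delta M (st c) col with
  | (w, mv, q) =>
      Config q (if mv then (head c).+1 else (head c).-1)
        (fun t m => if m == head c then w t else tape c t m)
  end.

Definition init {k} (M : machine k) (inp : 'I_k) (a : real) : config k (nst M) :=
  Config (q_start M) 0 (fun t m => if t == inp then a m else false).

(* A halting run of M from c0: a configuration sequence indexed by a
   well-order (I, lt) (i.e. by an ordinal alpha + 1) obeying the successor
   rule and the limit rule (limit state, head at cell 0, cellwise limsup), and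
   whose last stage is the first stage in the halt state. *)
Record halting_run {k} (M : machine k) (c0 : config k (nst M)) : Type := HRun {
  I : Type;
  lt : I -> I -> Prop;
  lt_wf : well_founded lt;
  lt_trans : forall i j l, lt i j -> lt j l -> lt i l;
  lt_total : forall i j, lt i j \/ i = j \/ lt j i;
  conf : I -> config k (nst M);
  last : I;
  last_max : forall i, i <> last -> lt i last;
  run_init : forall i, (forall j, ~ lt j i) -> conf i = c0;
  run_succ : forall i j, lt i j -> (forall m, ~ (lt i m /\ lt m j)) ->
      conf j = step M (conf i);
  run_limit : forall j, (exists i, lt i j) ->
      (forall i, lt i j -> exists m, lt i m /\ lt m j) ->
      st (conf j) = q_lim M /\ head (conf j) = 0 /\
      forall t n, (tape (conf j) t n = true <->
        forall i, lt i j -> exists m,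
          (lt i m \/ i = m) /\ lt m j /\ tape (conf m) t n = true);
  run_halt : st (conf last) = q_halt M;
  run_not_halt_before : forall i, lt i last -> st (conf i) <> q_halt M }.
Arguments conf {k M c0}. Arguments last {k M c0}.

Definition output {k} {M : machine k} {c0} (R : halting_run M c0) (out : 'I_k)
  : real := tape (conf R (last R)) out.

Definition halts_with {k} (M : machine k) (inp out : 'I_k) (a b : real) : Prop :=
  exists R : halting_run M (init M inp a), output R out = b.

Definition ittm_computable (f : real -> option real) : Prop :=
  exists M : machine 3, forall a b,
    halts_with M ord0 (ord_max : 'I_3) a b <-> f a = Some b.

Definition one_tape_computable (f : real -> option real) : Prop :=
  exists M : machine 1, forall a b,
    halts_with M ord0 ord0 a b <-> f a = Some b.

(* Main.v *)
From mathcomp Require Import all_boot.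
From mathcomp Require Import zify.
From Stdlib Require Import Classical ClassicalEpsilon FunctionalExtensionality.
From Stdlib Require Import Eqdep Relation_Operators Lexicographic_Product.
Require Import Defs.
Set Implicit Arguments. Unset Strict Implicit.

(** Each kind of machine simulates the other.

    A one-tape machine has no room for the two extra tapes: before stage omega
    it cannot spread its input, since every visited cell still carries
    information.  It spreads the input in omega passes of length omega, pass
    [n] inserting four blank cells behind the [n]-th input bit, and recognizes
    stage omega^2 by a cell that is flashed once in every pass.  It then
    simulates the three tapes block by block, and finally packs the output
    bits to the left.  Cell 0 is set to 1 for this last phase, so that the
    limit that ends it can be told from all other limits; this 1 is the extra
    bit in front of the output.  Conversely, a three-tape machine runs the
    one-tape machine on its first tape and copies the result, without its first
    bit, to its output tape.

    That the simulating machine halts only when the simulated one does follows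
    without analysing its runs: a run that does not halt can be continued along
    any well-order, hence so can its simulation, which then is longer than the
    given halting run, contradicting determinism. *)

(** * Runs along well-orders *)

Record well_order (J : Type) (R : J -> J -> Prop) : Prop := WellOrder {
  wo_wf : well_founded R;
  wo_trans : forall i j l, R i j -> R j l -> R i l;
  wo_total : forall i j, R i j \/ i = j \/ R j i }.

Lemma wf_irrefl (J : Type) (R : J -> J -> Prop) :
  well_founded R -> forall x, ~ R x x.
Proof. by move=> wf; elim/(well_founded_ind wf) => x IH xx; apply: (IH x xx). Qed.

Lemma wf_min (J : Type) (R : J -> J -> Prop) (D : J -> Prop) :
  well_founded R -> (exists x, D x) ->
  exists2 x, D x & forall y, R y x -> ~ D y.
Proof.
move=> wf [x Dx]; apply: NNPP => no; elim/(well_founded_ind wf): x Dx => x IH Dx.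
by apply: no; exists x => // y yx Dy; apply: (IH y yx Dy).
Qed.

Lemma wo_asym (J : Type) (R : J -> J -> Prop) x y :
  well_order R -> R x y -> ~ R y x.
Proof. by move=> wo xy yx; apply: (wf_irrefl (wo_wf wo) (wo_trans wo xy yx)). Qed.

Lemma config_eq k n (c c' : config k n) :
  st c = st c' -> head c = head c' ->
  (forall t m, tape c t m = tape c' t m) -> c = c'.
Proof.
case: c c' => [q h T] [q' h' T'] /= -> -> eT; congr Config.
by apply: functional_extensionality => t; apply: functional_extensionality.
Qed.

Section Runs.
Variables (k : nat) (M : machine k).
Notation cfg := (config k (nst M)).
Implicit Types (c : cfg) (P : 'I_k -> nat -> bool -> Prop).

(* [c] is what the successor or the limit rule produces after the stages in
   [D], according to whether [D] has a largest element. *)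
Definition next_of (J : Type) (R : J -> J -> Prop) (cf : J -> cfg)
    (D : J -> Prop) (c : cfg) : Prop :=
  (exists x, [/\ D x, forall y, D y -> R y x \/ y = x & c = step M (cf x)]) \/
  [/\ exists x, D x, forall x, D x -> exists2 y, D y & R x y,
      st c = q_lim M, head c = 0 &
      forall t n, tape c t n = true <->
        forall i, D i -> exists m, [/\ R i m \/ i = m, D m & tape (cf m) t n = true]].

Definition obeys (J : Type) (R : J -> J -> Prop) (c0 : cfg) (cf : J -> cfg) :=
  forall j, ((forall i, ~ R i j) /\ cf j = c0) \/
            next_of R cf (fun i => R i j) (cf j).

(** All stages are before halting; a halting configuration stays outside, as what [next_of] yields
    after all of them. *)
Record is_run (J : Type) (R : J -> J -> Prop) (c0 : cfg) (cf : J -> cfg) : Prop :=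
  IsRun { run_wo : well_order R;
          run_obeys : obeys R c0 cf;
          run_going : forall j, st (cf j) <> q_halt M }.

Lemma next_of_nonempty J R (cf : J -> cfg) D c :
  next_of R cf D c -> exists x, D x.
Proof. by case=> [[x [Dx _ _]]|[]] //; exists x. Qed.

Lemma next_of_exists J R (cf : J -> cfg) D :
  well_order R -> (exists x, D x) -> exists c, next_of R cf D c.
Proof.
move=> wo ne.
case: (classic (exists2 x, D x & forall y, D y -> R y x \/ y = x)) => [[x Dx mx]|nomax].
  by exists (step M (cf x)); left; exists x.
pose B t n := forall i, D i ->
  exists m, [/\ R i m \/ i = m, D m & tape (cf m) t n = true].
exists (Config (q_lim M) 0
  (fun t n => if excluded_middle_informative (B t n) then true else false)).
right; split=> // [x Dx|t n /=]; last by case: excluded_middle_informative.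
apply: NNPP => no; apply: nomax; exists x => // y Dy.
case: (wo_total wo x y) => [xy|[->|]]; [|by right|by left].
by case: no; exists y.
Qed.

(* [E] matches a final part of [DJ] with a final part of [DK]. *)
Lemma next_of_rel J K (RJ : J -> J -> Prop) (RK : K -> K -> Prop)
    (cfJ : J -> cfg) (cfK : K -> cfg) (E : J -> K -> Prop) DJ DK c :
  well_order RJ -> well_order RK ->
  (forall x y x' y', E x y -> E x' y' -> RJ x x' <-> RK y y') ->
  (forall x y, E x y -> cfJ x = cfK y) ->
  (forall x, DJ x -> exists2 y, DK y & E x y) ->
  (forall y, DK y -> (exists2 x, DJ x & E x y) \/
                     (forall x y', DJ x -> E x y' -> RK y y')) ->
  next_of RJ cfJ DJ c -> next_of RK cfK DK c.
Proof.
move=> woJ woK mono ecf fwd bwd.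
have uK x y y' : E x y -> E x y' -> y = y'.
  move=> e e'; case: (wo_total woK y y') => [l|[//|l]].
    by case: (wf_irrefl (wo_wf woJ) ((mono _ _ _ _ e e').2 l)).
  by case: (wf_irrefl (wo_wf woJ) ((mono _ _ _ _ e' e).2 l)).
have uJ x x' y : E x y -> E x' y -> x = x'.
  move=> e e'; case: (wo_total woJ x x') => [l|[//|l]].
    by case: (wf_irrefl (wo_wf woK) ((mono _ _ _ _ e e').1 l)).
  by case: (wf_irrefl (wo_wf woK) ((mono _ _ _ _ e' e).1 l)).
case=> [[x [Dx mx ->]]|[[x0 Dx0] nomax cs ch ct]].
  have [y Dy e] := fwd _ Dx.
  left; exists y; split=> //; last by rewrite (ecf _ _ e).
  move=> y' Dy'; case: (bwd _ Dy') => [[x' Dx' e']|/(_ _ _ Dx e)]; last by left.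
  case: (mx _ Dx') => [l|eq]; first by left; apply: (mono _ _ _ _ e' e).1.
  by right; rewrite eq in e'; apply: uK e' e.
have [y0 Dy0 e0] := fwd _ Dx0.
right; split=> //; first by exists y0.
  move=> y Dy; case: (bwd _ Dy) => [[x Dx e]|b]; last by exists y0 => //; apply: b e0.
  have [x' Dx' l] := nomax _ Dx; have [y' Dy' e'] := fwd _ Dx'.
  by exists y' => //; apply: (mono _ _ _ _ e e').1.
move=> t n; rewrite ct; split=> H.
  move=> y Dy; case: (bwd _ Dy) => [[x Dx e]|b].
    have [m [l Dm tm]] := H _ Dx; have [y' Dy' e'] := fwd _ Dm.
    exists y'; split=> //; last by rewrite -(ecf _ _ e').
    case: l => [l|eq]; first by left; apply: (mono _ _ _ _ e e').1.
    by right; subst m; apply: uK e e'.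
  (* An unmatched [y] lies below the whole matched part, so any witness above [x0] serves. *)
  have [m [l Dm tm]] := H _ Dx0; have [y' Dy' e'] := fwd _ Dm.
  by exists y'; split=> //; [left; apply: b e'|rewrite -(ecf _ _ e')].
move=> x Dx; have [y Dy e] := fwd _ Dx; have [m [l Dm tm]] := H _ Dy.
case: (bwd _ Dm) => [[x' Dx' e']|b].
  exists x'; split=> //; last by rewrite (ecf _ _ e').
  case: l => [l|eq]; first by left; apply: (mono _ _ _ _ e e').2.
  by right; subst m; apply: uJ e e'.
have ym := b _ _ Dx e.
case: l => [l|eq]; first by case: (wo_asym woK l ym).
by subst m; case: (wf_irrefl (wo_wf woK) ym).
Qed.

Lemma next_of_emb J K (RJ : J -> J -> Prop) (RK : K -> K -> Prop)
    (cfJ : J -> cfg) (cfK : K -> cfg) (e : J -> K) DJ DK c :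
  well_order RJ -> well_order RK ->
  (forall x y, RJ x y -> RK (e x) (e y)) ->
  (forall x, cfK (e x) = cfJ x) ->
  (forall x, DJ x -> DK (e x)) ->
  (forall y, DK y -> (exists2 x, DJ x & y = e x) \/ (forall x, DJ x -> RK y (e x))) ->
  next_of RJ cfJ DJ c -> next_of RK cfK DK c.
Proof.
move=> woJ woK mono ecf fwd bwd.
apply: (@next_of_rel _ _ _ _ _ _ (fun x y => y = e x)) => //.
- move=> x _ x' _ -> ->; split=> [|l]; first exact: mono.
  case: (wo_total woJ x x') => [//|[eq|/mono/(wo_asym woK)//]].
  by subst; case: (wf_irrefl (wo_wf woK) l).
- by move=> x _ ->.
- by move=> x Dx; exists (e x) => //; apply: fwd.
by move=> y /bwd [|b]; [left|right=> x _ Dx ->; apply: b].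
Qed.

(** A set with a largest element cannot be a limit, so the two rules exclude each other; each fixes
    the configuration. *)
Lemma next_of_unique J R (cf : J -> cfg) D c c' :
  well_order R -> next_of R cf D c -> next_of R cf D c' -> c = c'.
Proof.
move=> wo; case=> [[x [Dx mx ->]]|[_ nomax cs ch ct]];
  case=> [[x' [Dx' mx' ->]]|[_ nomax' cs' ch' ct']].
- case: (mx _ Dx') => [l|->//]; case: (mx' _ Dx) => [l'|->//].
  by case: (wo_asym wo l l').
- have [y Dy l] := nomax' _ Dx; case: (mx _ Dy) => [l'|eq].
    by case: (wo_asym wo l l').
  by subst y; case: (wf_irrefl (wo_wf wo) l).
- have [y Dy l] := nomax _ Dx'; case: (mx' _ Dy) => [l'|eq].
    by case: (wo_asym wo l l').
  by subst y; case: (wf_irrefl (wo_wf wo) l).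
apply: config_eq; rewrite ?cs ?ch // => t n.
by apply/idP/idP => [/ct/ct'|/ct'/ct].
Qed.

(** Well-founded recursion, each value chosen by [epsilon]; [next_of] looks only at stages below
    [j], where the extended function [ext] agrees with the final one. *)
Lemma obeys_exists J (R : J -> J -> Prop) c0 :
  well_order R -> exists cf, obeys R c0 cf.
Proof.
move=> wo.
pose rule (cf : J -> cfg) (j : J) c :=
  ((forall i, ~ R i j) /\ c = c0) \/ next_of R cf (fun i => R i j) c.
(* The recursion knows only the earlier stages; elsewhere [c0] is a dummy value. *)
pose ext (j : J) (rec : forall i, R i j -> cfg) (i : J) : cfg :=
  if excluded_middle_informative (R i j) is left l then rec i l else c0.
pose F (j : J) (rec : forall i, R i j -> cfg) : cfg :=
  epsilon (inhabits c0) (rule (ext j rec) j).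
pose cf := Fix (wo_wf wo) (fun _ => cfg) F.
have cfE j : cf j = F j (fun i _ => cf i).
  apply: (Fix_eq (wo_wf wo) (fun _ => cfg) F) => i f g fg; congr F.
  by apply: functional_extensionality_dep => y; apply: functional_extensionality_dep.
exists cf => j; rewrite cfE /F.
set g := ext _ _.
have: rule g j (epsilon (inhabits c0) (rule g j)).
  apply: epsilon_spec; case: (classic (exists i, R i j)) => [ne|no].
    by have [c nc] := next_of_exists g wo ne; exists c; right.
  by exists c0; left; split=> // i l; apply: no; exists i.
case=> [|nx]; first by left.
right; move: nx; set c := epsilon _ _.
apply: (@next_of_rel _ _ _ _ _ _ (fun x y => R x j /\ x = y)) => //.
- by move=> x _ x' _ [_ <-] [_ <-].
- by move=> x _ [l <-]; rewrite /g /ext; case: excluded_middle_informative.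
- by move=> x l; exists x.
by move=> y l; left; exists y.
Qed.

End Runs.
Arguments next_of {k} M {J}.
Arguments obeys {k} M {J}.
Arguments is_run {k} M {J}.

(** * Comparing stages of two well-orders by rank *)

Section Compare.
Variables (J K : Type) (RJ : J -> J -> Prop) (RK : K -> K -> Prop).

(** Equality of the ordinal ranks of [x] and [y], expressed by back and forth so that no ordinals
    are needed. *)
Inductive same_rank (x : J) (y : K) : Prop :=
  SameRank of (forall x', RJ x' x -> exists2 y', RK y' y & same_rank x' y')
            & (forall y', RK y' y -> exists2 x', RJ x' x & same_rank x' y').

Hypotheses (woJ : well_order RJ) (woK : well_order RK).

Lemma same_rank_fun x y y' : same_rank x y -> same_rank x y' -> y = y'.
Proof.
elim/(well_founded_ind (wo_wf woJ)): x y y' => x IH.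
suff no y y' : same_rank x y -> same_rank x y' -> ~ RK y y'.
  move=> y y' e e'; case: (wo_total woK y y') => [/(no _ _ e e')//|[//|]].
  by move/(no _ _ e' e).
move=> [f _] [_ b] /b [x' lx e']; have [y'' ly e''] := f _ lx.
by move: ly; rewrite (IH _ lx _ _ e'' e'); apply: wf_irrefl (wo_wf woK) _.
Qed.

Lemma same_rank_lt x y x' y' :
  same_rank x y -> same_rank x' y' -> RJ x x' -> RK y y'.
Proof.
move=> e [f _] /f [y'' l e'']; by rewrite (same_rank_fun e e'').
Qed.

(** Comparability of well-orders: the least [y] that no element below [x] matches has the rank of
    [x]. *)
Lemma same_rank_total x :
  (exists y, same_rank x y) \/ (forall y, exists2 x', RJ x' x & same_rank x' y).
Proof.
elim/(well_founded_ind (wo_wf woJ)): x => x IH.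
case: (classic (forall y, exists2 x', RJ x' x & same_rank x' y)) => [|no]; first by right.
have [y ny my] := wf_min (wo_wf woK) (not_all_ex_not _ _ no).
left; exists y; split=> [x' lx|y' /my/NNPP//].
case: (IH _ lx) => [[y' e]|/(_ y) [x'' lx' e]]; last first.
  by case: ny; exists x'' => //; apply: (wo_trans woJ) lx' lx.
exists y' => //; case: (wo_total woK y' y) => [//|[eq|l]].
  by case: ny; exists x' => //; rewrite -eq.
case: e => _ /(_ _ l) [x'' lx' e]; case: ny.
by exists x'' => //; apply: (wo_trans woJ) lx' lx.
Qed.

End Compare.

Lemma same_rank_sym (J K : Type) (RJ : J -> J -> Prop) (RK : K -> K -> Prop) x y :
  well_founded RJ -> same_rank RJ RK x y -> same_rank RK RJ y x.
Proof.
move=> wf; elim/(well_founded_ind wf): x y => x IH y [f b]; split.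
  by move=> y' /b [x' l e]; exists x' => //; apply: IH.
by move=> x' l; have [y' l' e] := f _ l; exists y' => //; apply: IH.
Qed.

Lemma same_rank_lt_iff (J K : Type) (RJ : J -> J -> Prop) (RK : K -> K -> Prop)
    x y x' y' :
  well_order RJ -> well_order RK ->
  same_rank RJ RK x y -> same_rank RJ RK x' y' -> RJ x x' <-> RK y y'.
Proof.
move=> woJ woK e e'; split; first exact: same_rank_lt e e'.
by apply: (same_rank_lt woK woJ); apply: same_rank_sym (wo_wf woJ) _.
Qed.

(** Determinism, by induction on the rank: the matching by rank below [x] and [y] transports the
    rule used at [x] to the one used at [y]. *)
Lemma obeys_same_rank k (M : machine k) (J K : Type)
    (RJ : J -> J -> Prop) (RK : K -> K -> Prop) c0 cfJ cfK x y :
  well_order RJ -> well_order RK ->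
  obeys M RJ c0 cfJ -> obeys M RK c0 cfK ->
  same_rank RJ RK x y -> cfJ x = cfK y.
Proof.
move=> woJ woK oJ oK; elim/(well_founded_ind (wo_wf woJ)): x y => x IH y e.
case: (oJ x) (oK y) => [[mx ->]|nx] [[my ->]|ny] //.
- have [y' l] := next_of_nonempty ny.
  by case: e => _ /(_ _ l) [x' /mx].
- have [x' l] := next_of_nonempty nx.
  by case: e => /(_ _ l) [y' /my].
apply: (next_of_unique woK _ ny).
apply: (next_of_rel (E := fun x' y' => RJ x' x /\ same_rank RJ RK x' y') woJ woK) nx.
- by move=> ? ? ? ? [_ e1] [_ e2]; apply: same_rank_lt_iff.
- by move=> x' y' [l e']; apply: IH.
- by case: e => f _ x' l; have [y' l' e'] := f _ l; exists y'.
by case: e => _ b y' l; left; have [x' l' e'] := b _ l; exists x'.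
Qed.

(** * Concatenating runs *)

Section Segments.
Variables (k : nat) (M : machine k).
Notation cfg := (config k (nst M)).
Notation cellpred := ('I_k -> nat -> bool -> Prop).
Implicit Types (c : cfg) (P : cellpred).

(* A nonempty run that leads from [c] to [c'], where [c'] itself is not a stage
   of the run; [P] bounds the values of the cells along the run. *)
Record segment P c c' := Segment {
  sg_ix : Type;
  sg_lt : sg_ix -> sg_ix -> Prop;
  sg_cf : sg_ix -> cfg;
  sg_run : is_run M sg_lt c sg_cf;
  sg_cells : forall x t n, P t n (tape (sg_cf x) t n);
  sg_next : next_of M sg_lt sg_cf (fun=> True) c' }.

Definition seg P c c' := inhabited (segment P c c').

(** Choice turns the existence of segments into data, from which the index type of a concatenation
    can be built. *)
Definition segment_of P c c' (s : seg P c c') : segment P c c' :=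
  proj1_sig (constructive_indefinite_description (fun=> True)
    (let: inhabits x := s in ex_intro _ x Logic.I)).

Lemma seg_step P c :
  st c <> q_halt M -> (forall t n, P t n (tape c t n)) -> seg P c (step M c).
Proof.
move=> nh Pc; apply: inhabits.
refine (@Segment _ _ _ unit (fun _ _ => False) (fun=> c) _ _ _) => //.
  split=> //; last by move=> j; left; split=> // i [].
  by split; [move=> x; split|move=> ? ? ?|move=> [] []; right; left].
by left; exists tt; split=> // [[]]; right.
Qed.

(** * Replacing each stage of a well-order by a whole segment *)

Section Refine.
Variables (J : Type) (R : J -> J -> Prop) (A S : J -> cfg) (P : J -> cellpred).
Hypothesis wo : well_order R.
Variable sg : forall i, segment (P i) (A i) (S i).

(* The analogue of [next_of] for stages [A i] that are joined by whole segments
   to [S i]: the cells of a limit are 1 because of the [A i], and 0 because the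
   bounds [P i] exclude 1 within the segments. *)
Definition macro_next (D : J -> Prop) c : Prop :=
  (exists x, [/\ D x, forall y, D y -> R y x \/ y = x & c = S x]) \/
  [/\ exists x, D x, forall x, D x -> exists2 y, D y & R x y,
      st c = q_lim M, head c = 0 &
      forall t n, if tape c t n
        then forall i, D i -> exists m, [/\ R i m \/ i = m, D m & tape (A m) t n = true]
        else exists2 i, D i & forall m, D m -> R i m \/ i = m -> ~ P m t n true].

(** The concatenation is indexed by the lexicographic sum of the orders of the segments. *)
Let K := {i : J & sg_ix (sg i)}.
Let lex : K -> K -> Prop := lexprod J (fun i => sg_ix (sg i)) R (fun i => @sg_lt _ _ _ (sg i)).
Let cfK (u : K) : cfg := sg_cf (projT2 u).

Let lexP i (x : sg_ix (sg i)) j (y : sg_ix (sg j)) :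
  lex (existT _ i x) (existT _ j y) -> R i j \/ i = j.
Proof. by move=> l; inversion l; [left|right]. Qed.

Let lex_same i (x y : sg_ix (sg i)) :
  lex (existT _ i x) (existT _ i y) -> sg_lt x y.
Proof.
(* Endpoints become variables with equations, so that case analysis on [lex] works for dependent
   pairs. *)
suff H u v : lex u v -> u = existT _ i x -> v = existT _ i y -> sg_lt x y.
  by move=> l; apply: H l erefl erefl.
case=> [j j' x' y' l|j x' y' l] eu ev.
  have e1 : j = i := f_equal (@projT1 _ _) eu; have e2 : j' = i := f_equal (@projT1 _ _) ev.
  by subst j j'; case: (wf_irrefl (wo_wf wo) l).
have e : j = i := f_equal (@projT1 _ _) eu; subst j.
by rewrite -(inj_pair2 _ _ _ _ _ eu) -(inj_pair2 _ _ _ _ _ ev).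
Qed.

Let woK : well_order lex.
Proof.
split.
- apply: wf_lexprod; first exact: wo_wf wo.
  by move=> i; apply: wo_wf (run_wo (sg_run (sg i))).
- move=> [i x] [j y] [h z] l1 l2.
  case: (lexP l1) (lexP l2) => [r1|e1] [r2|e2]; subst; try by left.
    by left; apply: (wo_trans wo) r1 r2.
  by right; apply: (wo_trans (run_wo (sg_run (sg h)))) (lex_same l1) (lex_same l2).
move=> [i x] [j y]; case: (wo_total wo i j) => [l|[e|l]].
- by left; left.
- subst j; case: (wo_total (run_wo (sg_run (sg i))) x y) => [l|[->|l]].
  + by left; right.
  + by right; left.
  + by right; right; right.
- by right; right; left.
Qed.

Let first_stage i : exists2 x : sg_ix (sg i), sg_cf x = A i & forall y, ~ sg_lt y x.
Proof.
have [x0 _] := next_of_nonempty (sg_next (sg i)).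
have [x _ mx] := wf_min (D := fun=> True) (wo_wf (run_wo (sg_run (sg i)))) (ex_intro _ x0 Logic.I).
have nx y : ~ sg_lt y x by move=> l; apply: mx l Logic.I.
exists x => //; case: (run_obeys (sg_run (sg i)) x) => [[]//|/next_of_nonempty [y /nx]//].
Qed.

(** If [D] has a largest element [i], segment [i] is a final part of the sum and its own [sg_next]
    applies. Otherwise the first stages of the segments supply the ones of the limit and the bounds
    the zeros. *)
Let macro_next_of D (DK : K -> Prop) c :
  (forall u, DK u <-> D (projT1 u)) -> (forall i j, R i j -> D j -> D i) ->
  macro_next D c -> next_of M lex cfK DK c.
Proof.
move=> DKE Ddown [[i [Di mi ->]]|[[i0 Di0] nomax cs ch ct]].
  refine (@next_of_emb _ _ _ _ _ lex _ cfK (fun x => existT _ i x) (fun=> True) DK _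
    (run_wo (sg_run (sg i))) woK _ _ _ _ (sg_next (sg i))) => //.
  - by move=> x y l; right.
  - by move=> x _; apply/DKE.
  move=> [j y] /DKE /= /mi [l|e]; first by right=> x _; left.
  by subst j; left; exists y.
right; split=> //.
- by have [x _ _] := first_stage i0; exists (existT _ i0 x); apply/DKE.
- move=> [i x] /DKE /= /nomax [j Dj l]; have [y _ _] := first_stage j.
  by exists (existT _ j y); [apply/DKE|left].
move=> t n; move: (ct t n); case: (tape c t n) => H; split=> //.
  (* The stage [x] may already be past the first stage of segment [i], so the witness is sought from
     a later [j] on. *)
  move=> _ [i x] /DKE /= Di; have [j Dj l] := nomax _ Di.
  have [m [l' Dm tm]] := H _ Dj; have [y ey _] := first_stage m.
  exists (existT _ m y); split; [|by apply/DKE|by rewrite /cfK /= ey].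
  by left; left; case: l' => [|<-//]; apply: (wo_trans wo).
move=> H'; case: H => i Di Hi; have [x _ _] := first_stage i.
have [[m y] [l /DKE /= Dm tm]] := H' (existT _ i x) ((DKE (existT _ i x)).2 Di).
case: (Hi _ Dm); last by rewrite -tm; apply: sg_cells.
case: l => [/lexP//|e]; right; exact: (f_equal (@projT1 _ _) e).
Qed.

(** The first stage of a segment is justified by the macro rule, the others by the rule inside the
    segment. The embedding [e] records that the new run is at least as long as [J]. *)
Lemma refine_run c0 :
  (forall i, ((forall j, ~ R j i) /\ A i = c0) \/ macro_next (fun j => R j i) (A i)) ->
  exists (K' : Type) (RK : K' -> K' -> Prop) (cf : K' -> cfg) (e : J -> K'),
    [/\ is_run M RK c0 cf,
        forall i j, R i j -> RK (e i) (e j),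
        forall u t n, exists i, P i t n (tape (cf u) t n) &
        forall c, macro_next (fun=> True) c -> next_of M RK cf (fun=> True) c].
Proof.
move=> rule.
have [e eP] : exists e : J -> K, forall i, projT1 (e i) = i.
  by exists (fun i => existT _ i (proj1_sig (constructive_indefinite_description _
    (next_of_nonempty (sg_next (sg i)))))).
exists K, lex, cfK, e; split.
- split=> //; last by move=> [i x]; apply: run_going (sg_run (sg i)) x.
  move=> [i x]; rewrite {2}/cfK /=; case: (run_obeys (sg_run (sg i)) x) => [[mx ex]|nx].
    rewrite /cfK /= ex; case: (rule i) => [[mi ->]|nx].
      left; split=> // [[j y] l]; case: (lexP l) => [/mi//|eq].
      by subst j; apply: mx (lex_same l).
    right; apply: macro_next_of nx; last by move=> *; apply: (wo_trans wo); eauto.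
    move=> [j y]; split=> /= [l|l]; last by left.
    case: (lexP l) => [//|eq]; subst j; by case: (mx _ (lex_same l)).
  right; refine (@next_of_emb _ _ _ _ _ lex _ cfK (fun x => existT _ i x) _
    (fun u => lex u (existT _ i x)) _ (run_wo (sg_run (sg i))) woK _ _ _ _ nx) => //.
  + by move=> y z l; right.
  + by move=> y l; right.
  move=> [j y] l; case: (lexP l) => [l'|eq]; first by right=> z _; left.
  by subst j; left; exists y => //; apply: lex_same.
- move=> i j; move: (eP i) (eP j); case: (e i) (e j) => [i' x] [j' y] /= <- <- l.
  by left.
- by move=> [i x] t n; exists i; apply: sg_cells.
move=> c; exact: macro_next_of.
Qed.

End Refine.

Lemma refine_seg (J : Type) (R : J -> J -> Prop) (A S : J -> cfg) (P : J -> cellpred) P' c0 c :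
  well_order R ->
  (forall i, seg (P i) (A i) (S i)) ->
  (forall i, ((forall j, ~ R j i) /\ A i = c0) \/
     macro_next R A S P (fun j => R j i) (A i)) ->
  (forall i t n b, P i t n b -> P' t n b) ->
  macro_next R A S P (fun=> True) c -> seg P' c0 c.
Proof.
move=> wo sg rule PP nx.
have f i : segment (P i) (A i) (S i) := segment_of (sg i).
have [K [RK [cf [e [run _ cells nK]]]]] := refine_run wo f rule.
apply: inhabits; exists K RK cf => //; last exact: nK.
by move=> u t n; have [i] := cells u t n; apply: PP.
Qed.

Lemma seg_weak P P' c c' :
  (forall t n b, P t n b -> P' t n b) -> seg P c c' -> seg P' c c'.
Proof. by move=> PP [[J R cf r cl nx]]; apply: inhabits; exists J R cf => // *; apply: PP. Qed.

(** Concatenation along the two-element order [false < true]. *)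
Lemma seg_trans P c1 c2 c3 : seg P c1 c2 -> seg P c2 c3 -> seg P c1 c3.
Proof.
move=> s1 s2.
pose R b b' := (b == false) && (b' == true).
have wo : well_order R.
  split.
  - have a0 : Acc R false by split=> [[]].
    case; last exact: a0.
    by split=> [[]] // _; exact: a0.
  - by case; case; case.
  - by case; case; auto.
refine (@refine_seg bool R (fun b => if b then c2 else c1)
  (fun b => if b then c3 else c2) (fun=> P) P c1 c3 wo _ _ _ _).
- by case.
- case; [right; left|left]; last by split=> // [[]].
  by exists false; split=> // [[]] //; right.
- by [].
by left; exists true; split=> // [[]]; [right|left].
Qed.

Lemma wo_ltn : well_order (fun m n : nat => m < n).
Proof.
split; [|by move=> i j l; apply: ltn_trans|].
  by move=> n; apply: (@Wf_nat.well_founded_lt_compat nat id) => x y /ltP.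
by move=> i j; case: (ltngtP i j); auto.
Qed.

(** Concatenation along omega has a limit only at its end: a 1 there must recur among the [A n], and
    a 0 must be enforced by the bounds from some segment on. *)
Lemma seg_omega (A : nat -> cfg) (P : nat -> cellpred) P' c :
  (forall n, seg (P n) (A n) (A n.+1)) ->
  (forall n t m b, P n t m b -> P' t m b) ->
  st c = q_lim M -> head c = 0 ->
  (forall t m, if tape c t m then forall i, exists2 n, i <= n & tape (A n) t m = true
               else exists i, forall n, i <= n -> ~ P n t m true) ->
  seg P' (A 0) c.
Proof.
move=> sg PP cs ch ct.
apply: (refine_seg (c0 := A 0) wo_ltn sg) => //.
  case=> [|n]; first by left.
  right; left; exists n; split=> // m; rewrite ltnS leq_eqVlt.
  by case/orP=> [/eqP|]; auto.
right; split; [by exists 0|by move=> x _; exists x.+1|exact: cs|exact: ch|].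
move=> t m; move: (ct t m); case: (tape c t m) => [H i _|[i Hi]].
  have [n l e] := H i; exists n; split=> //.
  by move: l; rewrite leq_eqVlt => /orP [/eqP|]; auto.
by exists i => // n _ l; apply: Hi; case: l => [/ltnW|->].
Qed.

End Segments.
Arguments segment {k} M.
Arguments seg {k} M.

(** * Halting and simulation *)

Arguments lt {k M c0 h}.
Arguments lt_total {k M c0 h}.
Arguments last_max {k M c0 h} [i].
Arguments run_limit {k M c0 h} [j].
Arguments run_halt {k M c0}.
Arguments run_not_halt_before {k M c0 h} [i].
Notation any_cell := (fun _ _ _ => True).

Definition add_top (J : Type) (R : J -> J -> Prop) (o o' : option J) : Prop :=
  match o, o' with
  | Some x, Some y => R x y | Some _, None => True | None, _ => False end.

Lemma wo_add_top (J : Type) (R : J -> J -> Prop) :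
  well_order R -> well_order (add_top R).
Proof.
move=> wo; have accS x : Acc (add_top R) (Some x).
  elim/(well_founded_ind (wo_wf wo)): x => x IH; split=> [[y|]] /= l; [exact: IH|by []].
split; first by case=> [x|]; [exact: accS|split=> [[y|]] // _; exact: accS].
  by move=> [x|] [y|] [z|] //=; apply: (wo_trans wo).
move=> [x|] [y|] /=; auto.
by case: (wo_total wo x y) => [|[->|]]; auto.
Qed.

Section Halting.
Variables (k : nat) (M : machine k).
Notation cfg := (config k (nst M)).
Implicit Types (c : cfg).

(** A [seg] is nonempty, so halting at the very first stage needs the case of equality. *)
Definition reaches c c' := c' = c \/ seg M any_cell c c'.

Lemma halting_wo c0 (H : halting_run M c0) : well_order (@lt _ _ _ H).
Proof. by split; [apply: lt_wf|apply: lt_trans|apply: lt_total]. Qed.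

(** A stage with an immediate predecessor has it as largest earlier stage; any other noninitial
    stage is a limit. *)
Lemma halting_obeys c0 (H : halting_run M c0) : obeys M (@lt _ _ _ H) c0 (conf H).
Proof.
move=> j; case: (classic (exists i, lt i j)) => [ne|no]; last first.
  have no' i : ~ lt i j by move=> l; apply: no; exists i.
  by left; split=> //; apply: run_init.
right; case: (classic (exists2 i, lt i j & forall m, ~ (lt i m /\ lt m j))) => [[i l adj]|nadj].
  left; exists i; split=> //; last exact: run_succ.
  move=> y ly; case: (lt_total y i) => [|[|l']]; [by left|by right|].
  by case: (adj y).
have dense i : lt i j -> exists m, lt i m /\ lt m j.
  move=> l; apply: NNPP => nm; apply: nadj; exists i => // m mm.
  by apply: nm; exists m.
have [cs [ch ct]] := run_limit ne dense.
right; split=> //; first by move=> x /dense [m []]; exists m.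
move=> t n; rewrite ct; split=> h i /h.
  by case=> m [lm [mj tm]]; exists m.
by case=> m [lm mj tm]; exists m.
Qed.

Lemma halting_of_obeys (J : Type) (R : J -> J -> Prop) c0 cf (z : J) :
  well_order R -> obeys M R c0 cf -> (forall i, i <> z -> R i z) ->
  st (cf z) = q_halt M -> (forall i, R i z -> st (cf i) <> q_halt M) ->
  exists H : halting_run M c0, conf H (last H) = cf z.
Proof.
move=> wo ob mz hz nh.
have succ i j : R i j -> (forall m, ~ (R i m /\ R m j)) -> cf j = step M (cf i).
  move=> l adj; case: (ob j) => [[/(_ i)//]|].
  case=> [[x [lx mx ->]]|[_ dense _ _ _]].
    by case: (mx _ l) => [l'|->//]; case: (adj x).
  by have [y ly iy] := dense _ l; case: (adj y).
have lim j : (exists i, R i j) -> (forall i, R i j -> exists m, R i m /\ R m j) ->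
    st (cf j) = q_lim M /\ head (cf j) = 0 /\
    forall t n, (tape (cf j) t n = true <->
      forall i, R i j -> exists m, (R i m \/ i = m) /\ R m j /\ tape (cf m) t n = true).
  move=> [i0 l0] dense; case: (ob j) => [[/(_ i0)//]|].
  case=> [[x [lx mx _]]|[_ _ cs ch ct]].
    have [y [l1 l2]] := dense _ lx.
    case: (mx _ l2) => [l|e]; first by case: (wo_asym wo l l1).
    by subst y; case: (wf_irrefl (wo_wf wo) l1).
  split=> //; split=> // t n; rewrite ct; split=> h i /h.
    by case=> m [lm mj tm]; exists m.
  by case=> m [lm [mj tm]]; exists m.
have ini i : (forall j, ~ R j i) -> cf i = c0.
  by move=> mi; case: (ob i) => [[]//|/next_of_nonempty [x /mi]].
by exists (@HRun _ M c0 J R (wo_wf wo) (wo_trans wo) (wo_total wo) cf z mz ini succ lim hz nh).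
Qed.

(** The configuration [c] is put on top of the run as its last stage. *)
Lemma halting_of_reaches c0 c :
  reaches c0 c -> st c = q_halt M ->
  exists H : halting_run M c0, conf H (last H) = c.
Proof.
move=> [->|[[J R cf [wo ob going] _ nx]]] hc.
  apply: (@halting_of_obeys unit (fun _ _ => False) c0 (fun=> c0) tt) => //.
  - by split; [move=> x; split|move=> ? ? ?|move=> [] []; right; left].
  - by move=> j; left; split=> // i [].
  - by case.
have woO := wo_add_top wo.
pose cfO o := if o is Some x then cf x else c.
apply: (@halting_of_obeys _ (add_top R) c0 cfO None) => //.
- case=> [x|]; last first.
    right; apply: (next_of_emb wo woO (e := @Some J)) nx => //.
    by move=> [x|] //= _; left; exists x.
  case: (ob x) => [[mx ex]|nx']; first by left; split=> // [[y|]] //=; apply: mx.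
  right; apply: (next_of_emb wo woO (e := @Some J)) nx' => //.
  by move=> [y|] //= l; left; exists y.
- by case.
by case=> [x|] // _; apply: going.
Qed.

Lemma reaches_of_obeys (J : Type) (R : J -> J -> Prop) c0 cf (z : J) :
  well_order R -> obeys M R c0 cf ->
  (forall i, R i z -> st (cf i) <> q_halt M) -> reaches c0 (cf z).
Proof.
move=> wo ob nh; case: (ob z) => [[_ ->]|nx]; first by left.
pose K := {i : J | R i z}; pose RK (u v : K) := R (proj1_sig u) (proj1_sig v).
have woK : well_order RK.
  split.
  - move=> [x lx]; elim/(well_founded_ind (wo_wf wo)): x lx => x IH lx.
    by split=> [[y ly]] l; apply: IH.
  - by move=> u v w; apply: (wo_trans wo).
  - move=> [x lx] [y ly]; case: (wo_total wo x y) => [|[e|]]; [by left| |by right; right].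
    by subst y; right; left; rewrite (proof_irrelevance _ lx ly).
right; apply: inhabits; exists K RK (fun u => cf (proj1_sig u)) => //.
  split=> //; last by move=> [x lx]; apply: nh.
  move=> [x lx]; case: (ob x) => [[mx ->]|nx']; first by left; split=> // [[y ly]]; apply: mx.
  right; apply: (next_of_rel (E := fun y u => y = proj1_sig u) wo woK) nx' => //.
  - by move=> y u y' u' -> ->.
  - by move=> y u ->.
  - by move=> y l; exists (exist _ y (wo_trans wo l lx)).
  - by move=> [y ly] l; left; exists y.
apply: (next_of_rel (E := fun y u => y = proj1_sig u) wo woK) nx => //.
- by move=> y u y' u' -> ->.
- by move=> y u ->.
- by move=> y l; exists (exist _ y l).
- by move=> [y ly] l; left; exists y.
Qed.

Lemma halting_reaches c0 (H : halting_run M c0) : reaches c0 (conf H (last H)).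
Proof.
apply: (reaches_of_obeys (halting_wo H) (@halting_obeys _ H)) => i.
exact: run_not_halt_before.
Qed.

(** If the last stages had different ranks, one run would meet the halt state of the other before
    its own last stage. *)
Lemma halting_unique c0 (H H' : halting_run M c0) :
  conf H (last H) = conf H' (last H').
Proof.
have [wo wo'] := (halting_wo H, halting_wo H').
have eqc x y := obeys_same_rank (x := x) (y := y) wo wo' (@halting_obeys _ H) (@halting_obeys _ H').
case: (same_rank_total wo wo' (last H)) => [[y e]|/(_ (last H')) [x l e]].
  case: (classic (y = last H')) => [->|ne] in e *; first exact: eqc.
  case: (run_not_halt_before (last_max ne)).
  by rewrite -(eqc _ _ e) run_halt.
by case: (run_not_halt_before l); rewrite (eqc _ _ e) run_halt.
Qed.

(* Matching ranks would embed [option (I H)] into [I H]. *)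
Lemma halting_not_longer c0 (H : halting_run M c0) (J : Type) (R : J -> J -> Prop) cf
    (e : option (I _ _ H) -> J) :
  is_run M R c0 cf ->
  (forall x y, lt x y -> R (e (Some x)) (e (Some y))) ->
  (forall x, R (e (Some x)) (e None)) -> False.
Proof.
move=> [wo ob going] mono top; have wo' := halting_wo H.
have eqc x y := obeys_same_rank (x := x) (y := y) wo wo' ob (@halting_obeys _ H).
have matched j : exists i, same_rank R (@lt _ _ _ H) j i.
  case: (same_rank_total wo wo' j) => [//|/(_ (last H)) [x l e']].
  by case: (going x); rewrite (eqc _ _ e') run_halt.
(* An increasing map of a well-order into itself moves no element down. But if [i] is the rank of
   [e None], then [e (Some i)] has a rank below [i]. *)
have low i i' : lt i' i -> ~ same_rank R (@lt _ _ _ H) (e (Some i)) i'.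
  elim/(well_founded_ind (wo_wf wo')): i i' => i IH i' l [f _].
  by have [i'' l' e'] := f _ (mono _ _ l); apply: IH l _ l' e'.
have [i [f _]] := matched (e None).
by have [i' l' e'] := f _ (top i); apply: low l' e'.
Qed.

(** The rules always define configurations along [R]; cut at the first halting stage, if any, they
    form a halting run. *)
Lemma run_or_halt (J : Type) (R : J -> J -> Prop) c0 :
  well_order R ->
  (exists H : halting_run M c0, True) \/ exists cf, is_run M R c0 cf.
Proof.
move=> wo; have [cf ob] := obeys_exists c0 wo.
case: (classic (exists j, st (cf j) = q_halt M)) => [ex|no]; last first.
  by right; exists cf; split=> // j h; apply: no; exists j.
have [j hj mj] := wf_min (wo_wf wo) ex; left.
have [H _] := halting_of_reaches (reaches_of_obeys wo ob mj) hj.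
by exists H.
Qed.

End Halting.
Arguments reaches {k} M.

(** * Simulation of a machine, stage by stage *)

Section Simulation.
Variables (k k' : nat) (M : machine k) (N : machine k').
(** [Elim c] is the code of [c] as a limit leaves it, in the limit state with the head at cell 0;
    [Ereg c] is the code with state and head restored. *)
Variables (Ereg Elim : config k (nst M) -> config k' (nst N)).
(* Every cell of [N] either is constant or mirrors a cell of [M]. *)
Variable src : 'I_k' -> nat -> bool + 'I_k * nat.

Definition mirror (c : config k (nst M)) (s : bool + 'I_k * nat) : bool :=
  match s with inl b => b | inr (t, n) => tape c t n end.

Hypothesis Ereg_tape : forall c t n, tape (Ereg c) t n = mirror c (src t n).
Hypothesis Elim_tape : forall c t n, tape (Elim c) t n = mirror c (src t n).
Hypothesis Elim_st : forall c, st (Elim c) = q_lim N.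
Hypothesis Elim_head : forall c, head (Elim c) = 0.
(** Within a step, cells may take only their old and new values, so that no spurious 1 enters a
    limit. *)
Hypothesis sim_step : forall c, st c <> q_halt M ->
  seg N (fun t n b => b = tape (Ereg c) t n \/ b = tape (Ereg (step M c)) t n)
    (Ereg c) (Ereg (step M c)).
Hypothesis sim_limit : forall c, st c = q_lim M -> head c = 0 ->
  seg N (fun t n b => b = tape (Ereg c) t n) (Elim c) (Ereg c).

Section Run.
Variables (J : Type) (R : J -> J -> Prop) (c0 : config k (nst M)).
Variables (cf : J -> config k (nst M)) (d0 : config k' (nst N)).
Hypothesis run : is_run M R c0 cf.
Hypothesis start : seg N any_cell d0 (Ereg c0).

Let wo := run_wo run.

(** The added bottom element indexes the initial segment from [d0] to [Ereg c0]. *)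
Definition opt_lt (o o' : option J) : Prop :=
  match o, o' with
  | Some x, Some y => R x y | None, Some _ => True | _, None => False end.

Let wo_opt : well_order opt_lt.
Proof.
have accN : Acc opt_lt None by split=> [[]].
split.
- case=> [x|]; last exact: accN.
  elim/(well_founded_ind (wo_wf wo)): x => x IH; split=> [[y|]] /= l; [exact: IH|exact: accN].
- by move=> [x|] [y|] [z|] //=; apply: (wo_trans wo).
- move=> [x|] [y|] /=; auto.
  by case: (wo_total wo x y) => [|[->|]]; auto.
Qed.

Let is_lim j := (exists i, R i j) /\ forall i, R i j -> exists2 m, R m j & R i m.
Let enc j := if excluded_middle_informative (is_lim j) then Elim (cf j) else Ereg (cf j).
Let A o := if o is Some j then enc j else d0.
Let S o := if o is Some j then Ereg (step M (cf j)) else Ereg c0.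
Let P (o : option J) (t : 'I_k') n b := if o is Some j
  then b = tape (Ereg (cf j)) t n \/ b = tape (Ereg (step M (cf j))) t n else True.
Let DO (D : J -> Prop) (o : option J) := if o is Some j then D j else True.

Let enc_lim j : is_lim j -> enc j = Elim (cf j).
Proof. by rewrite /enc; case: excluded_middle_informative. Qed.

Let enc_reg j : ~ is_lim j -> enc j = Ereg (cf j).
Proof. by rewrite /enc; case: excluded_middle_informative. Qed.

Let enc_tape j t n : tape (enc j) t n = mirror (cf j) (src t n).
Proof. by rewrite /enc; case: excluded_middle_informative => h; rewrite (Elim_tape, Ereg_tape). Qed.

Let links o : seg N (P o) (A o) (S o).
Proof.
case: o => [j|] //=; have reg := sim_step (run_going run (j := j)).
rewrite /enc; case: excluded_middle_informative => [[[i0 l0] dense]|] //.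
have [cs ch] : st (cf j) = q_lim M /\ head (cf j) = 0.
  case: (run_obeys run j) => [[/(_ i0)//]|].
  case=> [[x [lx mx _]]|[]] //; have [y ly xy] := dense _ lx.
  case: (mx _ ly) => [l|e]; first by case: (wo_asym wo l xy).
  by subst y; case: (wf_irrefl (wo_wf wo) xy).
apply: seg_trans reg; apply: seg_weak (sim_limit cs ch) => t n b ->; by left.
Qed.

(** The bound of a step also admits the next values; in a limit set [D] these belong to a later
    stage of [D], so they are controlled too. *)
Let cofinal_succ D m : (forall x, D x -> exists2 y, D y & R x y) ->
  (forall x y, R x y -> D y -> D x) -> D m ->
  exists j, [/\ D j, R m j & cf j = step M (cf m)].
Proof.
move=> dense down Dm; have [j0 Dj0 l0] := dense _ Dm.
have [j l mj] := wf_min (D := R m) (wo_wf wo) (ex_intro _ j0 l0).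
have Dj : D j.
  case: (wo_total wo j j0) => [l'|[->//|l']]; first exact: down l' Dj0.
  by case: (mj _ l').
exists j; split=> //; case: (run_obeys run j) => [[/(_ m)//]|].
case=> [[x [lx mx ->]]|[_ nomax _ _ _]].
  by case: (mx _ l) => [/mj|->//].
by have [y /mj] := nomax _ l.
Qed.

Let next_succ D x c : D x -> (forall y, D y -> R y x \/ y = x) -> c = step M (cf x) ->
  macro_next opt_lt A S P (DO D) (Ereg c).
Proof.
move=> Dx mx ->; left; exists (Some x); split=> // [[y|]] /=; last by left.
by move=> /mx [|->]; auto.
Qed.

(** The limsup is computed cell by cell along [src]. A mirrored cell that is 0 in [c] is 0 in all
    stages from some [i] on, hence also within the steps between them. *)
Let next_lim D c :
  (exists x, D x) -> (forall x, D x -> exists2 y, D y & R x y) ->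
  (forall x y, R x y -> D y -> D x) ->
  (forall t n, tape c t n = true <->
     forall i, D i -> exists m, [/\ R i m \/ i = m, D m & tape (cf m) t n = true]) ->
  macro_next opt_lt A S P (DO D) (Elim c).
Proof.
move=> [x0 Dx0] dense down ct; right; split=> //.
- by exists None.
- move=> [x|] /= Dx; last by exists (Some x0).
  by have [y Dy l] := dense _ Dx; exists (Some y).
move=> t n; rewrite Elim_tape; case E : (src t n) => [[]|[t' n']] /=.
- move=> [i|] /= Di; last by exists (Some x0); split; rewrite /= ?enc_tape ?E; auto.
  by exists (Some i); split; rewrite /= ?enc_tape ?E; auto.
- exists (Some x0) => // [[m|]] Dm l; last by case: l.
  by rewrite /P !Ereg_tape E /=; case.
case C : (tape c t' n').
  have up i : D i -> exists m, [/\ R i m \/ i = m, D m & tape (enc m) t n = true].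
    move=> Di; have [m [l Dm tm]] := (ct t' n').1 C i Di.
    by exists m; rewrite enc_tape E.
  move=> [i|] /= Di.
    by have [m [l Dm tm]] := up i Di; exists (Some m); split=> //; case: l => [|->]; auto.
  by have [m [l Dm tm]] := up x0 Dx0; exists (Some m); split=> //; left.
have [i Di ni] : exists2 i, D i & forall m, D m -> R i m \/ i = m -> tape (cf m) t' n' = false.
  apply: NNPP => no; suff: tape c t' n' = true by rewrite C.
  apply/ct => i Di; apply: NNPP => nm; apply: no; exists i => // m Dm l.
  by apply/negbTE/negP => tm; apply: nm; exists m.
exists (Some i) => // [[m|]] Dm; last by case.
move=> l; have {}l : R i m \/ i = m by case: l => [|[]]; auto.
rewrite /P !Ereg_tape E /= ni //.
have [j [Dj lj <-]] := cofinal_succ dense down Dm.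
rewrite ni //; first by case.
by left; case: l => [l|->//]; apply: (wo_trans wo) l lj.
Qed.

Lemma simulate_run :
  exists (K : Type) (RK : K -> K -> Prop) (cfN : K -> config k' (nst N)) (e : J -> K),
    [/\ is_run N RK d0 cfN,
        forall i j, R i j -> RK (e i) (e j) &
        forall c, next_of M R cf (fun=> True) c -> exists2 d,
          next_of N RK cfN (fun=> True) d &
          d = Ereg c \/ [/\ d = Elim c, st c = q_lim M & head c = 0]].
Proof.
have f o : segment N (P o) (A o) (S o) := segment_of (links o).
have down j x y : R x y -> R y j -> R x j by apply: (wo_trans wo).
have rule o : ((forall o', ~ opt_lt o' o) /\ A o = d0) \/
    macro_next opt_lt A S P (fun o' => opt_lt o' o) (A o).
  case: o => [j|]; last by left; split=> //; case=> [x|] [].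
  have DE : (fun o' => opt_lt o' (Some j)) = DO (fun i => R i j).
    by apply: functional_extensionality => [[]].
  rewrite DE; right; case: (run_obeys run j) => [[mj ej]|].
    left; exists None; split; [by []|by case=> [y /mj|_]; [|right]|].
    by rewrite /= enc_reg ?ej // => [[[i /mj]]].
  case=> [[x [lx mx ex]]|[ne dense cs ch ct]].
    rewrite /= enc_reg; first exact: next_succ lx mx ex.
    case=> _ dense; have [y ly xy] := dense _ lx.
    case: (mx _ ly) => [l|e]; first by case: (wo_asym wo l xy).
    by subst y; case: (wf_irrefl (wo_wf wo) xy).
  by rewrite /= enc_lim //; apply: next_lim ct => //; apply: down.
have [K [RK [cfN [e [runN mono _ nxN]]]]] := refine_run wo_opt f rule.
exists K, RK, cfN, (fun j => e (Some j)); split=> //.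
  by move=> i j l; apply: mono.
have DT : (fun=> True) = DO (fun=> True).
  by apply: functional_extensionality => [[]].
move=> c; case=> [[x [Dx mx ex]]|[ne dense cs ch ct]].
  exists (Ereg c); last by left.
  by apply: nxN; rewrite DT; apply: next_succ Dx mx ex.
exists (Elim c); last by right.
by apply: nxN; rewrite DT; apply: next_lim.
Qed.

End Run.

Variables (inp out : 'I_k) (inp' out' : 'I_k') (phi : real -> real).
Hypothesis sim_start : forall a, seg N any_cell (init N inp' a) (Ereg (init M inp a)).
Hypothesis sim_halt : forall c, st c = q_halt M -> exists d,
  [/\ seg N any_cell (Ereg c) d, st d = q_halt N & tape d out' = phi (tape c out)].

Lemma simulate_halts a b : halts_with M inp out a b -> halts_with N inp' out' a (phi b).
Proof.
move=> [H <-]; set c := conf H (last H).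
suff [d []] : exists d, [/\ reaches N (init N inp' a) d, st d = q_halt N &
    tape d out' = phi (tape c out)].
  by move=> /halting_of_reaches h /h [H' e] <-; exists H'; rewrite /output e.
have [d [fin hd od]] := sim_halt (run_halt H).
exists d; split=> //; right.
apply: seg_trans fin; case: (halting_reaches H) => [->|]; first exact: sim_start.
move=> [[J R cf run _ nx]].
have [K [RK [cfN [e [runN _ /(_ _ nx) [d' nd hd']]]]]] := simulate_run run (sim_start a).
have sd : seg N any_cell (init N inp' a) d' by apply: inhabits; exists K RK cfN.
case: hd' => [<-//|[ed cs ch]]; rewrite ed in sd.
by apply: seg_trans sd _; apply: seg_weak (sim_limit cs ch).
Qed.

(** Run [M] along the order of the given halting run with a top added. If [M] did not halt, its
    simulation would be too long; so it halts, and determinism of [N] identifies the outputs. *)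
Lemma simulate_halts_only a b :
  halts_with N inp' out' a b -> exists2 b', halts_with M inp out a b' & b = phi b'.
Proof.
move=> [H <-].
have wo := halting_wo H.
case: (run_or_halt (init M inp a) (wo_add_top wo)) => [[HM _]|[cf run]]; last first.
  have [K [RK [cfN [e [runN mono _]]]]] := simulate_run run (sim_start a).
  by case: (halting_not_longer (H := H) (e := e) runN) => *; apply: mono.
have hM : halts_with M inp out a (output HM out) by exists HM.
exists (output HM out) => //.
have [H' <-] := simulate_halts hM.
by rewrite /output (halting_unique H H').
Qed.

End Simulation.

(** * Machines over an arbitrary finite state type *)

Section Build.
Variables (k : nat) (Q : Type) (F : finType) (enc : Q -> F) (dec : F -> option Q).
Variable tr : Q -> {ffun 'I_k -> bool} -> {ffun 'I_k -> bool} * bool * Q.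
Variables q0 qh ql : Q.

(** States of a [machine] must be numbers, so [Q] is embedded into a finite type whose elements are
    numbered. *)
Definition code q : 'I_#|F| := enum_rank (enc q).

Definition build : machine k :=
  @Machine k #|F| (fun i col =>
    let: (w, mv, q) := tr (odflt q0 (dec (enum_val i))) col in (w, mv, code q))
    (code q0) (code qh) (code ql).

Hypothesis encK : pcancel enc dec.

Lemma code_inj : injective code.
Proof. by move=> q q' /enum_rank_inj /(pcan_inj encK). Qed.

Lemma build_step q h T :
  step build (Config (code q) h T) =
  let: (w, mv, q') := tr q [ffun t => T t h] in
  Config (code q' : 'I_(nst build)) (if mv then h.+1 else h.-1)
    (fun t m => if m == h then w t else T t m).
Proof. by rewrite /step /= enum_rankK encK /=; case: (tr _ _) => [[w mv] q']. Qed.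

End Build.

(** * One-tape machines with steps of several moves *)

Section Macro.
Variables (Q : Type) (F : finType) (enc : Q -> F) (dec : F -> option Q).
Hypothesis encK : pcancel enc dec.
(* [del q b] gives the symbol to write, the direction, the number of moves
   (1 to 5) and the next state. *)
Variable del : Q -> bool -> bool * bool * nat * Q.
Variables q0 qh ql : Q.

(* The direction is reset when no move is pending, to keep states unique. *)
Definition pending (q : Q) (d : bool) (n : nat) : Q * bool * 'I_5 :=
  (q, d && (0 < n), inord n).

Definition macro_tr (s : Q * bool * 'I_5) (col : {ffun 'I_1 -> bool}) :
    {ffun 'I_1 -> bool} * bool * (Q * bool * 'I_5) :=
  let: (q, d, n) := s in
  if n == 0 :> nat then
    let: (w, d', n', q') := del q (col ord0) in ([ffun=> w], d', pending q' d' n'.-1)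
  else (col, d, pending q d n.-1).

Definition macro_enc (s : Q * bool * 'I_5) : F * bool * 'I_5 :=
  (enc s.1.1, s.1.2, s.2).
Definition macro_dec (s : F * bool * 'I_5) : option (Q * bool * 'I_5) :=
  omap (fun q => (q, s.1.2, s.2)) (dec s.1.1).

Lemma macro_encK : pcancel macro_enc macro_dec.
Proof. by move=> [[q d] n]; rewrite /macro_dec /= encK. Qed.

Definition machine1 : machine 1 :=
  build macro_enc macro_dec macro_tr (pending q0 false 0) (pending qh false 0)
    (pending ql false 0).

Definition pend_cf q d n h (T : nat -> bool) : config 1 (nst machine1) :=
  Config (code macro_enc (pending q d n)) h (fun=> T).

Definition cf1 q h T := pend_cf q false 0 h T.

Lemma pend_cf0 q d h T : pend_cf q d 0 h T = cf1 q h T.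
Proof. by rewrite /cf1 /pend_cf /pending andbF. Qed.

Lemma pend_step (P : nat -> bool -> Prop) q d n h T :
  n < 4 -> (forall m, P m (T m)) ->
  seg machine1 (fun=> P) (pend_cf q d n.+1 h T)
    (pend_cf q d n (if d then h.+1 else h.-1) T).
Proof.
move=> ln PT.
have -> : pend_cf q d n (if d then h.+1 else h.-1) T = step machine1 (pend_cf q d n.+1 h T).
  rewrite /pend_cf /= (build_step _ _ _ _ macro_encK) /= inordK // andbT.
  apply: config_eq => //= t m; case: eqP => // ->.
  by rewrite ffunE.
apply: seg_step => // /(code_inj macro_encK) [_ _] /(congr1 val).
by rewrite /= !inordK.
Qed.

(** Subtraction truncates at 0 just as the head stops at cell 0, so left moves compose to
    [h - n]. *)
Lemma pend_run (P : nat -> bool -> Prop) c q d n h T :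
  n < 5 -> (forall m, P m (T m)) ->
  seg machine1 (fun=> P) c (pend_cf q d n h T) ->
  seg machine1 (fun=> P) c (cf1 q (if d then h + n else h - n) T).
Proof.
move=> ln PT; elim: n h ln => [|n IH] h ln s.
  by rewrite addn0 subn0 if_same -(pend_cf0 q d).
have -> : (if d then h + n.+1 else h - n.+1) =
    (if d then (if d then h.+1 else h.-1) + n else (if d then h.+1 else h.-1) - n).
  by case: d {s IH}; lia.
by apply: IH; [lia|apply: seg_trans s _; apply: pend_step].
Qed.

Lemma macro_step (P : nat -> bool -> Prop) q h T b w d n q' h' T' :
  q <> qh -> T h = b -> del q b = (w, d, n, q') -> 0 < n <= 5 ->
  h' = (if d then h + n else h - n) ->
  (forall m, T' m = if m == h then w else T m) ->
  (forall m, P m (T m)) -> (forall m, P m (T' m)) ->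
  seg machine1 (fun=> P) (cf1 q h T) (cf1 q' h' T').
Proof.
move=> nq Th dq /andP [n0 n5] -> eT PT PT'.
have -> : (if d then h + n else h - n) =
    (if d then (if d then h.+1 else h.-1) + n.-1 else (if d then h.+1 else h.-1) - n.-1).
  by case: d {dq}; lia.
apply: pend_run => //; first by lia.
have -> : pend_cf q' d n.-1 (if d then h.+1 else h.-1) T' = step machine1 (cf1 q h T).
  rewrite /cf1 /pend_cf /= (build_step _ _ _ _ macro_encK) /= inordK // ffunE Th dq /=.
  by apply: config_eq => //= t m; rewrite eT; case: eqP => // _; rewrite ffunE.
apply: seg_step => // /(code_inj macro_encK) [] //.
Qed.

End Macro.

(** * Simulating three tapes on one *)

Definition tp0 : 'I_3 := @Ordinal 3 0 isT.
Definition tp1 : 'I_3 := @Ordinal 3 1 isT.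
Definition tp2 : 'I_3 := @Ordinal 3 2 isT.

Definition of3 (A : Type) (x y z : A) (t : 'I_3) : A :=
  match val t with 0 => x | 1 => y | _ => z end.

Lemma of3_eta (A : Type) (f : 'I_3 -> A) t : f t = of3 (f tp0) (f tp1) (f tp2) t.
Proof. by case: t => [[|[|[|//]]] l]; rewrite /of3 /=; congr f; apply: val_inj. Qed.

Ltac decide_ifs :=
  repeat first [rewrite ifT; last by lia | rewrite ifN; last by lia].

Section OneTape.
Variable M : machine 3.
Let Qm := 'I_(nst M).

(** [Shift] holds four bits in transit; [Limit] to [Limit4] inspect the flags; [Seek] looks for the
    first block not yet made; [Sim] to [Move] perform a step; [Rewind] to [Put] pack the output. *)
Inductive state1 :=
  | Shift of bool & bool & bool & bool
  | Limit | Limit1 | Limit2 | Limit3 | Limit4 | Seek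
  | Sim of Qm | Read1 of Qm | Read2 of Qm & bool | Read3 of Qm & bool & bool
  | Write2 of bool & bool & bool & Qm | Write1 of bool & bool & Qm
  | Move of bool & Qm
  | Rewind | Pack0 | Pack | Pack1 | Pack2 | Pack3
  | Back of bool | Put | Halt.

Definition enc1 (s : state1) : 'I_23 * Qm * (bool * bool * bool * bool) :=
  let q0 := q_start M in
  match s with
  | Shift a b c d => (@Ordinal 23 0 isT, q0, (a, b, c, d))
  | Limit => (@Ordinal 23 1 isT, q0, (true, true, true, true))
  | Limit1 => (@Ordinal 23 2 isT, q0, (true, true, true, true))
  | Limit2 => (@Ordinal 23 3 isT, q0, (true, true, true, true))
  | Limit3 => (@Ordinal 23 4 isT, q0, (true, true, true, true))
  | Limit4 => (@Ordinal 23 5 isT, q0, (true, true, true, true))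
  | Seek => (@Ordinal 23 6 isT, q0, (true, true, true, true))
  | Sim q => (@Ordinal 23 7 isT, q, (true, true, true, true))
  | Read1 q => (@Ordinal 23 8 isT, q, (true, true, true, true))
  | Read2 q x => (@Ordinal 23 9 isT, q, (x, true, true, true))
  | Read3 q x y => (@Ordinal 23 10 isT, q, (x, y, true, true))
  | Write2 y x d q => (@Ordinal 23 11 isT, q, (y, x, d, true))
  | Write1 x d q => (@Ordinal 23 12 isT, q, (x, d, true, true))
  | Move d q => (@Ordinal 23 13 isT, q, (d, true, true, true))
  | Rewind => (@Ordinal 23 14 isT, q0, (true, true, true, true))
  | Pack0 => (@Ordinal 23 15 isT, q0, (true, true, true, true))
  | Pack => (@Ordinal 23 16 isT, q0, (true, true, true, true))
  | Pack1 => (@Ordinal 23 17 isT, q0, (true, true, true, true))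
  | Pack2 => (@Ordinal 23 18 isT, q0, (true, true, true, true))
  | Pack3 => (@Ordinal 23 19 isT, q0, (true, true, true, true))
  | Back g => (@Ordinal 23 20 isT, q0, (g, true, true, true))
  | Put => (@Ordinal 23 21 isT, q0, (true, true, true, true))
  | Halt => (@Ordinal 23 22 isT, q0, (true, true, true, true))
  end.

Definition dec1 (s : 'I_23 * Qm * (bool * bool * bool * bool)) : option state1 :=
  let: (t, q, (a, b, c, d)) := s in
  Some match val t with
  | 0 => Shift a b c d | 1 => Limit | 2 => Limit1 | 3 => Limit2 | 4 => Limit3
  | 5 => Limit4 | 6 => Seek | 7 => Sim q | 8 => Read1 q | 9 => Read2 q a
  | 10 => Read3 q a b | 11 => Write2 a b c q | 12 => Write1 a b q | 13 => Move a q
  | 14 => Rewind | 15 => Pack0 | 16 => Pack | 17 => Pack1 | 18 => Pack2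
  | 19 => Pack3 | 20 => Back a | 21 => Put | _ => Halt
  end.

Lemma enc1K : pcancel enc1 dec1. Proof. by case. Qed.

(* Layout: cells 0, 1, 2 are flags F, G, H; the column of cells [i] of the
   three tapes is the block 1 x y z 0 starting at cell 3 + 5i.  F is set only
   while the output is packed.  Spreading the input takes omega many passes of
   length omega, each inserting four zeros; G is flashed at the start of each
   pass, hence is 1 exactly at limits from omega^2 on.  H tells the stage
   omega^2 from later limits. *)
Definition del1 (s : state1) (b : bool) : bool * bool * nat * state1 :=
  match s with
  | Shift x y z u => (x, true, 1, Shift y z u b)
  | Limit => if b then (true, true, 1, Halt) else (false, true, 1, Limit1)
  | Limit1 => if b then (true, true, 1, Limit4) else (true, false, 1, Limit2)
  | Limit2 => (b, true, 1, Limit3)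
  | Limit3 => (false, true, 2, Seek)
  | Limit4 => (true, true, 1, Sim (if b then q_lim M else q_start M))
  | Seek => if b then (true, true, 5, Seek)
            else (true, true, 2, Shift false false false false)
  | Sim q => if b then if q == q_halt M then (true, false, 5, Rewind)
                       else (true, true, 1, Read1 q)
             else (false, true, 3, Sim q)
  | Read1 q => (b, true, 1, Read2 q b)
  | Read2 q x => (b, true, 1, Read3 q x b)
  | Read3 q x y =>
      let: (w, d, q') := delta M q [ffun t => of3 x y b t] in
      (w tp2, false, 1, Write2 (w tp1) (w tp0) d q')
  | Write2 y x d q => (y, false, 1, Write1 x d q)
  | Write1 x d q => (x, false, 1, Move d q)
  | Move d q => (b, d, 5, Sim q)
  | Rewind => if b then (true, false, 5, Rewind) else (true, true, 2, Pack0)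
  | Pack0 => (false, true, 1, Pack)
  | Pack => if b then (false, true, 1, Pack1) else (false, true, 1, Pack)
  | Pack1 => (false, true, 1, Pack2)
  | Pack2 => (false, true, 1, Pack3)
  | Pack3 => (false, false, 1, Back b)
  | Back g => if b then (g, true, 1, Put) else (false, false, 1, Back g)
  | Put => (true, true, 1, Pack)
  | Halt => (b, true, 1, Halt)
  end.

Definition pack_machine : machine 1 :=
  machine1 enc1 dec1 del1 (Shift false false false false) Halt Limit.

Notation cf := (cf1 enc1 dec1 del1 (Shift false false false false) Halt Limit).
Notation seg1 P := (seg pack_machine (fun=> P)).

Lemma step1 (P : nat -> bool -> Prop) q h T b w d n q' h' T' :
  q <> Halt -> T h = b -> del1 q b = (w, d, n, q') -> 0 < n <= 5 ->
  h' = (if d then h + n else h - n) ->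
  (forall m, T' m = if m == h then w else T m) ->
  (forall m, P m (T m)) -> (forall m, P m (T' m)) ->
  seg1 P (cf q h T) (cf q' h' T').
Proof. by move=> ? ? ? ? ? ? ? ?; apply: (macro_step enc1K); eassumption. Qed.

Lemma keep1 (P : nat -> bool -> Prop) q h T b d n q' h' :
  q <> Halt -> T h = b -> del1 q b = (b, d, n, q') -> 0 < n <= 5 ->
  h' = (if d then h + n else h - n) ->
  (forall m, P m (T m)) ->
  seg1 P (cf q h T) (cf q' h' T).
Proof.
move=> nq Th dq ln eh PT; apply: (step1 nq Th dq ln eh _ PT PT) => m.
by case: eqP => // ->.
Qed.

Definition src1 (m : nat) : bool + 'I_3 * nat :=
  match m with
  | 0 => inl false | 1 => inl true | 2 => inl true
  | m.+3 => match m %% 5 with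
    | 0 => inl true | 1 => inr (tp0, m %/ 5) | 2 => inr (tp1, m %/ 5)
    | 3 => inr (tp2, m %/ 5) | _ => inl false end
  end.

Variant src1_view : nat -> bool + 'I_3 * nat -> Prop :=
  | SrcF : src1_view 0 (inl false)
  | SrcG : src1_view 1 (inl true)
  | SrcH : src1_view 2 (inl true)
  | SrcMark i : src1_view (3 + 5 * i) (inl true)
  | SrcX i : src1_view (4 + 5 * i) (inr (tp0, i))
  | SrcY i : src1_view (5 + 5 * i) (inr (tp1, i))
  | SrcZ i : src1_view (6 + 5 * i) (inr (tp2, i))
  | SrcPad i : src1_view (7 + 5 * i) (inl false).

Lemma src1P m : src1_view m (src1 m).
Proof.
case: m => [|[|[|m]]]; try by constructor.
have lr : m %% 5 < 5 by rewrite ltn_mod.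
have E := divn_eq m 5; rewrite /src1; move: (m %/ 5) (m %% 5) lr E => i r.
case: r => [|[|[|[|[|//]]]]] _ ->; rewrite mulnC.
- by rewrite addn0; apply: (SrcMark i).
- have -> : (5 * i + 1).+3 = 4 + 5 * i by lia.
  exact: (SrcX i).
- have -> : (5 * i + 2).+3 = 5 + 5 * i by lia.
  exact: (SrcY i).
- have -> : (5 * i + 3).+3 = 6 + 5 * i by lia.
  exact: (SrcZ i).
- have -> : (5 * i + 4).+3 = 7 + 5 * i by lia.
  exact: (SrcPad i).
Qed.

Lemma src1_block i :
  [/\ src1 (3 + 5 * i) = inl true, src1 (4 + 5 * i) = inr (tp0, i),
      src1 (5 + 5 * i) = inr (tp1, i), src1 (6 + 5 * i) = inr (tp2, i) &
      src1 (7 + 5 * i) = inl false].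
Proof.
have S r : r < 5 -> src1 (r + 5 * i).+3 = match r with
    | 0 => inl true | 1 => inr (tp0, i) | 2 => inr (tp1, i) | 3 => inr (tp2, i)
    | _ => inl false end.
  move=> lr; have [e1 e2] : (r + 5 * i) %% 5 = r /\ (r + 5 * i) %/ 5 = i by lia.
  by rewrite /src1 e1 e2.
split; [exact: (S 0 isT)|exact: (S 1 isT)|exact: (S 2 isT)|exact: (S 3 isT)|exact: (S 4 isT)].
Qed.

Implicit Type c : config 3 (nst M).

Definition tape1 c (m : nat) : bool := mirror c (src1 m).
Definition reg1 c := cf (Sim (st c)) (3 + 5 * head c) (tape1 c).
Definition lim1 c := cf Limit 0 (tape1 c).

Lemma tape1_step c w d q :
  delta M (st c) [ffun t => tape c t (head c)] = (w, d, q) ->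
  forall m, tape1 (step M c) m =
    if m == 4 + 5 * head c then w tp0 else if m == 5 + 5 * head c then w tp1
    else if m == 6 + 5 * head c then w tp2 else tape1 c m.
Proof.
move=> E m; rewrite /tape1 /step E; case: src1P => [|||i|i|i|i|i] //=; try by rewrite !ifN //; lia.
- by case: (i =P head c) => [->|ne]; rewrite ?eqxx // !ifN //; lia.
- case: (i =P head c) => [->|ne]; last by rewrite !ifN //; lia.
  by rewrite ifN ?eqxx //; lia.
- case: (i =P head c) => [->|ne]; last by rewrite !ifN //; lia.
  by rewrite ifN; last lia; rewrite ifN ?eqxx //; lia.
Qed.

(** The block is read from left to right and written from right to left. Each cell changes at most
    once, from its old to its new value, as the bound demands. *)
Lemma sim_step1 c : st c <> q_halt M ->
  seg1 (fun n b => b = tape1 c n \/ b = tape1 (step M c) n) (reg1 c) (reg1 (step M c)).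
Proof.
move=> /eqP/negbTE nh; case E: (delta M (st c) [ffun t => tape c t (head c)]) => [[w d] q].
have ts := tape1_step E; rewrite {2}/reg1.
have -> : st (step M c) = q by rewrite /step E.
have -> : head (step M c) = if d then (head c).+1 else (head c).-1 by rewrite /step E.
move: ts; set U := tape1 (step M c); set T := tape1 c; set h := head c => ts.
have [s3 s4 s5 s6 _] := src1_block h.
have PT n : T n = T n \/ T n = U n by left.
have PU n : U n = T n \/ U n = U n by right.
pose V2 m := if m == 6 + 5 * h then w tp2 else T m.
pose V1 m := if m == 5 + 5 * h then w tp1 else V2 m.
have PV2 n : V2 n = T n \/ V2 n = U n.
  rewrite /V2; case: eqP => [->|]; last by left.
  by right; rewrite ts; decide_ifs.
have PV1 n : V1 n = T n \/ V1 n = U n.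
  rewrite /V1; case: eqP => // ->; right; rewrite ts; by decide_ifs.
apply: (@seg_trans _ _ _ _ (cf (Read1 (st c)) (4 + 5 * h) T)).
  apply: (@keep1 _ _ _ _ true true 1) => //; first by rewrite /T /tape1 s3.
    by rewrite /= nh.
  lia.
apply: (@seg_trans _ _ _ _ (cf (Read2 (st c) (tape c tp0 h)) (5 + 5 * h) T)).
  by apply: (@keep1 _ _ _ _ (tape c tp0 h) true 1) => //; [rewrite /T /tape1 s4|lia].
apply: (@seg_trans _ _ _ _ (cf (Read3 (st c) (tape c tp0 h) (tape c tp1 h)) (6 + 5 * h) T)).
  by apply: (@keep1 _ _ _ _ (tape c tp1 h) true 1) => //; [rewrite /T /tape1 s5|lia].
apply: (@seg_trans _ _ _ _ (cf (Write2 (w tp1) (w tp0) d q) (5 + 5 * h) V2)).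
  apply: (@step1 _ _ _ _ (tape c tp2 h) (w tp2) false 1) => //.
    by rewrite /T /tape1 s6.
  rewrite /=; have -> : [ffun t => of3 (tape c tp0 h) (tape c tp1 h) (tape c tp2 h) t] =
      [ffun t => tape c t (head c)].
    by apply/ffunP => t; rewrite !ffunE (of3_eta (fun t => tape c t (head c))).
  by rewrite E.
apply: (@seg_trans _ _ _ _ (cf (Write1 (w tp0) d q) (4 + 5 * h) V1)).
  apply: (@step1 _ _ _ _ (V2 (5 + 5 * h)) (w tp1) false 1) => //; lia.
apply: (@seg_trans _ _ _ _ (cf (Move d q) (3 + 5 * h) U)).
  apply: (@step1 _ _ _ _ (V1 (4 + 5 * h)) (w tp0) false 1) => //; lia.
have U3 : U (3 + 5 * h) = true by rewrite ts; decide_ifs; rewrite /T /tape1 s3.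
have mv h' : h' = (if d then 3 + 5 * h + 5 else 3 + 5 * h - 5) ->
    seg1 (fun n b => b = T n \/ b = U n) (cf (Move d q) (3 + 5 * h) U) (cf (Sim q) h' U).
  by move=> eh; apply: (@keep1 _ _ _ _ true d 5).
case: d mv {E} => mv; first by apply: mv; lia.
case h0 : h mv => [|h1] mv; last by apply: mv; lia.
(* A left move from block 0 stops at cell 0, whose flag F is 0; this sends [Sim] back to cell 3. *)
apply: seg_trans (mv 0 _) _; first by lia.
by apply: (@keep1 _ _ _ _ false true 3).
Qed.

(** The flags F = 0, G = 1, H = 1 are those of a limit of the simulation proper. *)
Lemma sim_limit1 c : st c = q_lim M -> head c = 0 ->
  seg1 (fun n b => b = tape1 c n) (lim1 c) (reg1 c).
Proof.
move=> cs ch; rewrite /reg1 cs ch.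
apply: (@seg_trans _ _ _ _ (cf Limit1 1 (tape1 c))).
  by apply: (@keep1 _ _ _ _ false true 1).
apply: (@seg_trans _ _ _ _ (cf Limit4 2 (tape1 c))).
  by apply: (@keep1 _ _ _ _ true true 1).
by apply: (@keep1 _ _ _ _ true true 1).
Qed.


Lemma seek_run (P : nat -> bool -> Prop) d n T : (forall m, P m (T m)) ->
  (forall i, i < n -> T (3 + 5 * i) = true) ->
  seg1 P d (cf Seek 3 T) -> seg1 P d (cf Seek (3 + 5 * n) T).
Proof.
move=> PT; elim: n => [|n IH] ones s; first by rewrite muln0 addn0.
apply: seg_trans (IH _ s) _; first by move=> i l; apply: ones; lia.
by apply: (@keep1 _ _ _ _ true true 5) => //; [apply: ones|lia].
Qed.

Lemma rewind_run (P : nat -> bool -> Prop) d n T : (forall m, P m (T m)) ->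
  (forall i, i <= n -> T (3 + 5 * i) = true) ->
  seg1 P d (cf Rewind (3 + 5 * n) T) -> seg1 P d (cf Rewind 0 T).
Proof.
move=> PT; elim: n => [|n IH] ones s.
  by apply: seg_trans s _; apply: (@keep1 _ _ _ _ true false 5) => //; apply: ones.
apply: IH => [i l|]; first by apply: ones; lia.
apply: seg_trans s _.
by apply: (@keep1 _ _ _ _ true false 5) => //; [apply: ones|lia].
Qed.

Lemma back_run (P : nat -> bool -> Prop) d g lo j T : (forall m, P m (T m)) ->
  (forall x, lo < x <= lo + j -> T x = false) ->
  seg1 P d (cf (Back g) (lo + j) T) -> seg1 P d (cf (Back g) lo T).
Proof.
move=> PT; elim: j => [|j IH] zeros s; first by rewrite addn0 in s.
apply: IH => [x l|]; first by apply: zeros; lia.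
apply: seg_trans s _.
by apply: (@keep1 _ _ _ _ false false 1) => //; [apply: zeros; lia|lia].
Qed.

Lemma pack_run (P : nat -> bool -> Prop) d lo j T : (forall m, P m (T m)) ->
  (forall x, lo <= x < lo + j -> T x = false) ->
  seg1 P d (cf Pack lo T) -> seg1 P d (cf Pack (lo + j) T).
Proof.
move=> PT; elim: j => [|j IH] zeros s; first by rewrite addn0.
apply: seg_trans (IH _ s) _; first by move=> x l; apply: zeros; lia.
by apply: (@keep1 _ _ _ _ false true 1) => //; [apply: zeros; lia|lia].
Qed.

(** When the head is at [h + j], the cells before it are final and the state holds the next four
    bits of [T']; so each cell stabilizes. *)
Lemma shift_pass (P : nat -> bool -> Prop) h T T' :
  (forall m, m < h -> T' m = T m) ->
  (forall j, T' (h + j) = if j < 4 then false else T (h + (j - 4))) ->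
  (forall m b, (m < h -> b = T m) -> P m b) ->
  seg1 P (cf (Shift false false false false) h T) (cf Limit 0 T').
Proof.
move=> low up PP; pose Z j := T' (h + j).
pose A j := cf (Shift (Z j) (Z j.+1) (Z j.+2) (Z j.+3)) (h + j)
  (fun m => if m < h + j then T' m else T m).
have -> : cf (Shift false false false false) h T = A 0.
  rewrite /A /Z !up /= addn0; congr cf1.
  by apply: functional_extensionality => m; case: ltnP => // /low.
apply: (@seg_omega _ pack_machine A (fun j _ m b => m < h + j -> b = T' m)) => //.
- move=> j; apply: (@step1 _ _ _ _ (Z j.+4) (Z j) true 1) => //.
  + by rewrite /= ltnn /Z up; case: ltnP => [|_]; [lia|congr T; lia].
  + by rewrite /= addn1 addnS.
  + move=> m; case: (m =P h + j) => [->|ne]; first by rewrite ifT //; lia.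
    by case: (ltnP m (h + j)) => l; [rewrite ifT|rewrite ifN]; lia.
  + by move=> m ->.
  + by move=> m l; rewrite ifT //; lia.
- move=> j _ m b H; apply: PP => l; rewrite -low //; apply: H; lia.
move=> t m /=; case E: (T' m).
  by move=> i; exists (maxn i m.+1); rewrite ?leq_maxl // ifT //; lia.
by exists m.+1 => n l H; move: E; rewrite -H //; lia.
Qed.

Section Start.
Variable a : real.
Let c0 := init M ord0 a.
Let X := tape1 c0.

(* The input after [n] passes: [n] blocks, a 0, and the rest of the input. *)
Let spread n g m := if m == 1 then g else if m == 2 then false
  else if m < 3 + 5 * n then X m else if m == 3 + 5 * n then false
  else a (m - (4 + 5 * n) + n).
(** The tape at stage omega^2: all is in place except that H is still 0. *)
Let spread_all m := if m == 2 then false else X m.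
(** In pass [n] the first [n] blocks are already final; among the flags only G varies. *)
Let P n m b := m < 3 + 5 * n -> m <> 1 -> b = spread_all m.

Let Pspread n g m : P n m (spread n g m).
Proof. by move=> l /eqP/negbTE n1; rewrite /spread n1 l. Qed.

Let XE i : [/\ X (3 + 5 * i) = true, X (4 + 5 * i) = a i, X (5 + 5 * i) = false,
  X (6 + 5 * i) = false & X (7 + 5 * i) = false].
Proof. by rewrite /X /tape1; case: (src1_block i) => -> -> -> -> ->. Qed.

(** G is raised here and lowered early in the following pass. Thus it is 0 at the next limit, but 1
    at cofinally many stages below omega^2. *)
Lemma flash_flag n : seg1 (P n) (cf Limit 0 (spread n false)) (cf Limit2 0 (spread n true)).
Proof.
apply: (@seg_trans _ _ _ _ (cf Limit1 1 (spread n false))).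
  by apply: (@keep1 _ _ _ _ false true 1) => // m; apply: Pspread.
apply: (@step1 _ _ _ _ false true false 1) => // m; try exact: Pspread.
by rewrite /spread; case: eqP.
Qed.

Lemma insert_pass n :
  seg1 (P n) (cf Limit2 0 (spread n true)) (cf Limit 0 (spread n.+1 false)).
Proof.
apply: (@seg_trans _ _ _ _ (cf Limit3 1 (spread n true))).
  by apply: (@keep1 _ _ _ _ false true 1) => // m; apply: Pspread.
have s : seg1 (P n) (cf Limit3 1 (spread n true)) (cf Seek 3 (spread n false)).
  apply: (@step1 _ _ _ _ true false true 2) => // m; try exact: Pspread.
  by rewrite /spread; case: eqP.
have {}s : seg1 (P n) (cf Limit3 1 (spread n true)) (cf Seek (3 + 5 * n) (spread n false)).
  apply: seek_run s => [m|i l]; first exact: Pspread.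
  by rewrite /spread; decide_ifs; case: (XE i).
apply: seg_trans s _.
(* Block [n] gets its mark, and its input bit stays in the cell after it. The four inserted zeros
   are the rest of the block and the missing mark of block [n.+1]. *)
pose T1 m := if m == 3 + 5 * n then true else spread n false m.
have PT1 m : P n m (T1 m).
  by rewrite /T1; case: eqP => [-> l|_]; [lia|apply: Pspread].
have [x3 x4 x5 x6 x7] := XE n.
apply: (@seg_trans _ _ _ _ (cf (Shift false false false false) (5 + 5 * n) T1)).
  apply: (@step1 _ _ _ _ false true true 2) => //; try exact: Pspread; last by lia.
  by rewrite /spread; decide_ifs.
apply: shift_pass.
- move=> m l; rewrite /T1 /spread.
  case: (m =P 1) => [->//|n1]; case: (m =P 2) => [->//|n2].
  case: (m =P 3 + 5 * n) => [->|n3]; first by decide_ifs.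
  case: (m =P 4 + 5 * n) => [->|n4]; decide_ifs => //.
  by rewrite x4; congr a; lia.
- move=> [|[|[|[|j]]]] /=; rewrite /T1 /spread; decide_ifs => //.
  + by rewrite addn0.
  + by rewrite -x6; congr X; lia.
  + by rewrite -x7; congr X; lia.
  + by congr a; lia.
move=> m b H l n1; rewrite H; last by lia.
by rewrite -(PT1 m l n1).
Qed.

Lemma sim_start1 : seg pack_machine any_cell (init pack_machine ord0 a) (reg1 c0).
Proof.
have -> : init pack_machine ord0 a = cf (Shift false false false false) 0 a.
  by apply: config_eq => //= t m; rewrite (ord1 t).
(* The first pass puts four zeros in front of the input: the three flags and the missing mark of
   block 0. *)
apply: (@seg_trans _ _ _ _ (cf Limit 0 (spread 0 false))).
  by apply: shift_pass => // [[|[|[|[|j]]]]] //=; rewrite /spread; decide_ifs; congr a; lia.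
apply: (@seg_trans _ _ _ _ (cf Limit2 0 (spread 0 true))).
  exact: seg_weak (flash_flag 0).
apply: (@seg_trans _ _ _ _ (cf Limit 0 spread_all)).
  (* The passes are joined just after the flash, which makes the recurring 1 in G visible. *)
  apply: (@seg_omega _ pack_machine (fun n => cf Limit2 0 (spread n true)) (fun n _ => P n)) => //.
    move=> n; apply: seg_trans (insert_pass n) _; apply: seg_weak (flash_flag n.+1) => _ m b H l.
    by apply: H; lia.
  move=> t m /=; case E: (spread_all m).
    move=> i; exists (maxn i m); first exact: leq_maxl.
    case: (m =P 1) => [->|n1] //; rewrite (Pspread (n := maxn i m)) //; lia.
  exists m => n l H; suff: true = spread_all m by rewrite E.
  by apply: H; [lia|move=> e; rewrite e in E].
(* Here F = 0, G = 1, H = 0: [Limit4] sets H and enters the start state of [M]. *)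
apply: (@seg_trans _ _ _ _ (cf Limit1 1 spread_all)).
  by apply: (@keep1 _ _ _ _ false true 1).
apply: (@seg_trans _ _ _ _ (cf Limit4 2 spread_all)).
  by apply: (@keep1 _ _ _ _ true true 1).
apply: (@step1 _ _ _ _ false true true 1) => // m.
by rewrite /spread_all; case: eqP => // ->.
Qed.

End Start.

Section Finish.
Variable c : config 3 (nst M).
Let T := tape1 c.
Let g := tape c tp2.

(* [i] bits are packed in cells 1 to [i]; cell [i.+1] is marked by a 1 and
   followed by zeros up to block [i]. *)
Let U i m := if m <= i then cons1 g m else if m == i.+1 then true
  else if m < 3 + 5 * i then false else T m.
Let P i m b := m <= i -> b = cons1 g m.

Let PU i m : P i m (U i m). Proof. by rewrite /U => l; rewrite l. Qed.

Let TE i : [/\ T (3 + 5 * i) = true, T (6 + 5 * i) = g i & T (7 + 5 * i) = false].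
Proof. by rewrite /T /tape1; case: (src1_block i) => -> _ _ -> ->. Qed.

Lemma pack_bit i :
  seg1 (P i) (cf Pack (3 + 5 * i) (U i)) (cf Pack (3 + 5 * i.+1) (U i.+1)).
Proof.
(* [V j] has the first [j] cells of block [i] erased; [W] also has the output bit stored in the
   marked cell. *)
pose V j m := if 3 + 5 * i <= m < 3 + 5 * i + j then false else U i m.
pose W m := if m == i.+1 then g i else V 4 m.
have [t3 t6 t7] := TE i.
have PV j m : P i m (V j m).
  by move=> l; rewrite /V ifN; [apply: PU|lia].
have PW m : P i m (W m).
  by move=> l; rewrite /W ifN; [apply: PV|lia].
have Vstep j m : V j.+1 m = if m == 3 + 5 * i + j then false else V j m.
  rewrite /V; case: (m =P _) => [->|ne]; first by decide_ifs.
  by case: ifP => l; [rewrite ifT|rewrite ifN]; lia.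
have V0 : U i = V 0.
  by apply: functional_extensionality => m; rewrite /V addn0 ifN //; lia.
have s : seg1 (P i) (cf Pack (3 + 5 * i) (U i)) (cf (Back (g i)) (i.+1 + (4 + 4 * i)) (V 4)).
  apply: (@seg_trans _ _ _ _ (cf Pack1 (4 + 5 * i) (V 1))).
    apply: (@step1 _ _ _ _ true false true 1) => //; try lia.
      by rewrite /U; decide_ifs.
    by move=> m; rewrite Vstep -V0 addn0.
  apply: (@seg_trans _ _ _ _ (cf Pack2 (5 + 5 * i) (V 2))).
    apply: (@step1 _ _ _ _ (V 1 (4 + 5 * i)) false true 1) => //; try lia.
    by move=> m; rewrite Vstep; have -> : 3 + 5 * i + 1 = 4 + 5 * i by lia.
  apply: (@seg_trans _ _ _ _ (cf Pack3 (6 + 5 * i) (V 3))).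
    apply: (@step1 _ _ _ _ (V 2 (5 + 5 * i)) false true 1) => //; try lia.
    by move=> m; rewrite Vstep; have -> : 3 + 5 * i + 2 = 5 + 5 * i by lia.
  apply: (@step1 _ _ _ _ (g i) false false 1) => //; try lia.
    by rewrite /V /U; decide_ifs.
  by move=> m; rewrite Vstep; have -> : 3 + 5 * i + 3 = 6 + 5 * i by lia.
have {}s : seg1 (P i) (cf Pack (3 + 5 * i) (U i)) (cf (Back (g i)) i.+1 (V 4)).
  apply: back_run s => // x l; rewrite /V /U; case: ifP => // l'.
  by decide_ifs.
have {}s : seg1 (P i) (cf Pack (3 + 5 * i) (U i)) (cf Pack i.+3 (U i.+1)).
  have PU' m : P i m (U i.+1 m) by move=> l; apply: PU; lia.
  apply: seg_trans s _; apply: (@seg_trans _ _ _ _ (cf Put i.+2 W)).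
    apply: (@step1 _ _ _ _ true (g i) true 1) => //; try lia.
    by rewrite /V /U; decide_ifs.
  apply: (@step1 _ _ _ _ (W i.+2) true true 1) => //; try lia.
  move=> m; rewrite /W /V /U.
  case: (m =P i.+2) => [->|n2]; first by decide_ifs.
  case: (m =P i.+1) => [->|n1]; first by decide_ifs.
  case: (leqP m i) => l0; first by decide_ifs.
  case: (leqP m (6 + 5 * i)) => l1.
    by case: (leqP (3 + 5 * i) m) => l2; decide_ifs.
  case: (m =P 7 + 5 * i) => [->|n7]; first by decide_ifs.
  by decide_ifs.
have -> : 3 + 5 * i.+1 = i.+3 + (5 + 4 * i) by lia.
apply: pack_run s => [m l|x l]; first by apply: PU; lia.
by rewrite /U; decide_ifs.
Qed.

Lemma sim_halt1 : st c = q_halt M -> exists d,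
  [/\ seg pack_machine any_cell (reg1 c) d, st d = q_halt pack_machine & tape d ord0 = cons1 (tape c ord_max)].
Proof.
move=> hc; exists (cf Halt 1 (cons1 g)); split=> //; last first.
  by rewrite /= /g; congr (cons1 (tape c _)); apply: val_inj.
have s : seg1 (fun _ _ => True) (reg1 c) (cf Rewind 0 T).
  have r h' : h' = 3 + 5 * head c - 5 -> seg1 (fun _ _ => True) (reg1 c) (cf Rewind h' T).
    move=> e; rewrite /reg1 hc; apply: (@keep1 _ _ _ _ true false 5) => //.
      by case: (TE (head c)).
    by rewrite /= eqxx.
  case: (head c) r => [|h] r; first exact: r.
  apply: (@rewind_run _ _ h) => //; last by apply: r; lia.
  by move=> i _; case: (TE i).
apply: seg_trans s _.
apply: (@seg_trans _ _ _ _ (cf Pack0 2 (fun m => if m == 0 then true else T m))).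
  by apply: (@step1 _ _ _ _ false true true 2).
apply: (@seg_trans _ _ _ _ (cf Pack 3 (U 0))).
  apply: (@step1 _ _ _ _ true false true 1) => // [[|[|[|m]]]] //=.
(* F = 1 makes [Limit] halt, and is the leading 1 of the output. *)
apply: (@seg_trans _ _ _ _ (cf Limit 0 (cons1 g))); last first.
  by apply: (@keep1 _ _ _ _ true true 1).
apply: (@seg_omega _ pack_machine (fun i => cf Pack (3 + 5 * i) (U i)) (fun i _ => P i)) => //.
  exact: pack_bit.
move=> t m /=; case E: (cons1 g m).
  by move=> i; exists (maxn i m); [apply: leq_maxl|rewrite PU ?E //; apply: leq_maxr].
by exists m => n l H; move: E; rewrite -H.
Qed.

End Finish.

End OneTape.

Theorem one_tape_simulates (M : machine 3) a b :
  halts_with (pack_machine M) ord0 ord0 a b <->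
  exists2 b', halts_with M ord0 ord_max a b' & b = cons1 b'.
Proof.
have tR (c : config 3 (nst M)) t n : tape (reg1 c) t n = mirror c (src1 n) by [].
have tL (c : config 3 (nst M)) t n : tape (lim1 c) t n = mirror c (src1 n) by [].
split.
  apply: (simulate_halts_only (Ereg := @reg1 M) (Elim := @lim1 M) tR tL) => //.
  - exact: sim_step1.
  - exact: sim_limit1.
  - exact: sim_start1.
  - exact: sim_halt1.
move=> [b' + ->].
apply: (simulate_halts (Ereg := @reg1 M) (Elim := @lim1 M) tR tL) => //.
- exact: sim_step1.
- exact: sim_limit1.
- exact: sim_start1.
- exact: sim_halt1.
Qed.

(** * Simulating one tape on three *)

Section ThreeTapes.
Variable M : machine 1.
Let Qm := 'I_(nst M).

Inductive state3 :=
  | Start3 | LimitT | Sim3 of Qm | Rewind3 | Copy | CopyWrite of bool | CopyNext | Halt3.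

Definition enc3 (s : state3) : 'I_8 * Qm * bool :=
  let q0 := q_start M in
  match s with
  | Start3 => (@Ordinal 8 0 isT, q0, true)
  | LimitT => (@Ordinal 8 1 isT, q0, true)
  | Sim3 q => (@Ordinal 8 2 isT, q, true)
  | Rewind3 => (@Ordinal 8 3 isT, q0, true)
  | Copy => (@Ordinal 8 4 isT, q0, true)
  | CopyWrite b => (@Ordinal 8 5 isT, q0, b)
  | CopyNext => (@Ordinal 8 6 isT, q0, true)
  | Halt3 => (@Ordinal 8 7 isT, q0, true)
  end.

Definition dec3 (s : 'I_8 * Qm * bool) : option state3 :=
  let: (t, q, b) := s in
  Some match val t with
  | 0 => Start3 | 1 => LimitT | 2 => Sim3 q | 3 => Rewind3 | 4 => Copy
  | 5 => CopyWrite b | 6 => CopyNext | _ => Halt3 end.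

Lemma enc3K : pcancel enc3 dec3. Proof. by case. Qed.

(* The first tape is the tape of [M].  The scratch tape marks cell 0 until [M]
   halts; then the mark is erased and the first tape is copied, shifted by one
   cell, to the output tape. *)
Definition del3 (s : state3) (x y z : bool) : bool * bool * bool * bool * state3 :=
  match s with
  | Start3 => (x, true, z, false, Sim3 (q_start M))
  | LimitT => (x, y, z, false, if y then Sim3 (q_lim M) else Halt3)
  | Sim3 q => if q == q_halt M then (x, y, z, false, Rewind3) else
      let: (w, d, q') := delta M q [ffun=> x] in (w ord0, y, z, d, Sim3 q')
  | Rewind3 => if y then (x, false, z, true, Copy) else (x, y, z, false, Rewind3)
  | Copy => (x, y, z, false, CopyWrite x)
  | CopyWrite b => (x, y, b, true, CopyNext)
  | CopyNext => (x, y, z, true, Copy)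
  | Halt3 => (x, y, z, true, Halt3)
  end.

Definition tr3 (s : state3) (col : {ffun 'I_3 -> bool}) :
    {ffun 'I_3 -> bool} * bool * state3 :=
  let: (x, y, z, d, s') := del3 s (col tp0) (col tp1) (col tp2) in
  ([ffun t => of3 x y z t], d, s').

Definition copy_machine : machine 3 := build enc3 dec3 tr3 Start3 Halt3 LimitT.

Definition cf3 s h (X Y Z : nat -> bool) : config 3 (nst copy_machine) :=
  Config (code enc3 s) h (of3 X Y Z).

Lemma step3 (P : 'I_3 -> nat -> bool -> Prop) s h X Y Z x y z d s' h' X' Y' Z' :
  s <> Halt3 -> del3 s (X h) (Y h) (Z h) = (x, y, z, d, s') ->
  h' = (if d then h.+1 else h.-1) ->
  (forall m, X' m = if m == h then x else X m) ->
  (forall m, Y' m = if m == h then y else Y m) ->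
  (forall m, Z' m = if m == h then z else Z m) ->
  (forall t m, P t m (of3 X Y Z t m)) ->
  seg copy_machine P (cf3 s h X Y Z) (cf3 s' h' X' Y' Z').
Proof.
move=> ns E -> eX eY eZ PT.
have -> : cf3 s' (if d then h.+1 else h.-1) X' Y' Z' = step copy_machine (cf3 s h X Y Z).
  rewrite /cf3 (build_step _ _ _ _ enc3K) /tr3 !ffunE /= E.
  apply: config_eq => //= t m; rewrite ffunE /of3.
  by case: (val t) => [|[|]]; rewrite ?eX ?eY ?eZ; case: eqP.
by apply: seg_step => // /(code_inj enc3K).
Qed.

Definition src3 (t : 'I_3) (n : nat) : bool + 'I_1 * nat :=
  of3 (inr (ord0, n)) (inl (n == 0)) (inl false) t.

Implicit Type c : config 1 (nst M).

Definition reg3 c := cf3 (Sim3 (st c)) (head c) (tape c ord0) (fun n => n == 0) (fun=> false).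
Definition lim3 c := cf3 LimitT 0 (tape c ord0) (fun n => n == 0) (fun=> false).

Lemma sim_step3 c : st c <> q_halt M ->
  seg copy_machine (fun t n b => b = tape (reg3 c) t n \/ b = tape (reg3 (step M c)) t n)
    (reg3 c) (reg3 (step M c)).
Proof.
move=> /eqP/negbTE nh; case E: (delta M (st c) [ffun t => tape c t (head c)]) => [[w d] q].
rewrite {4}/reg3 /step E /=.
apply: (@step3 _ _ _ _ _ _ (w ord0) (head c == 0) false d) => //; last by left.
  rewrite /= nh; have -> : [ffun=> tape c ord0 (head c)] = [ffun t => tape c t (head c)].
    by apply/ffunP => t; rewrite !ffunE (ord1 t).
  by rewrite E.
all: by move=> m; case: (m =P head c) => // ->.
Qed.

(** The mark in scratch cell 0 survives limits and shows that [M] is still running. *)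
Lemma sim_limit3 c : st c = q_lim M -> head c = 0 ->
  seg copy_machine (fun t n b => b = tape (reg3 c) t n) (lim3 c) (reg3 c).
Proof.
move=> cs ch; rewrite {2}/reg3 cs ch.
by apply: (@step3 _ _ _ _ _ _ (tape c ord0 0) true false false) => // m; case: eqP => // ->.
Qed.

Lemma sim_start3 a : seg copy_machine any_cell (init copy_machine ord0 a) (reg3 (init M ord0 a)).
Proof.
have -> : init copy_machine ord0 a = cf3 Start3 0 a (fun=> false) (fun=> false).
  by apply: config_eq => //= [[[|[|[|//]]] l]] m.
by apply: (@step3 _ _ _ _ _ _ (a 0) true false false) => // m; case: eqP => // ->.
Qed.

(** The mark stops the rewinding and is erased. Copying starts at cell 1, each bit being written one
    cell to its left; at the next limit the missing mark makes [LimitT] halt. *)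
Lemma sim_halt3 c : st c = q_halt M -> exists d,
  [/\ seg copy_machine any_cell (reg3 c) d, st d = q_halt copy_machine &
      tape d ord_max = (fun m => tape c ord0 m.+1)].
Proof.
move=> hc; set X := tape c ord0.
pose zero (_ : nat) := false; pose mark n := n == 0.
exists (cf3 Halt3 0 X zero (fun m => X m.+1)); split=> //.
have s : seg copy_machine any_cell (reg3 c) (cf3 Rewind3 (head c).-1 X mark zero).
  rewrite /reg3 hc; apply: (@step3 _ _ _ _ _ _ (X (head c)) (mark (head c)) false false) => //;
    try by move=> m; case: (m =P head c) => // ->.
  by rewrite /= eqxx.
have {}s : seg copy_machine any_cell (reg3 c) (cf3 Rewind3 0 X mark zero).
  elim: (head c).-1 s => [//|h IH] s; apply: IH; apply: seg_trans s _.
  apply: (@step3 _ _ _ _ _ _ (X h.+1) false false false) => //; by move=> m; case: (m =P h.+1) => // ->.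
apply: seg_trans s _.
apply: (@seg_trans _ _ _ _ (cf3 Copy 1 X zero zero)).
  apply: (@step3 _ _ _ _ _ _ (X 0) false false true) => // m; by rewrite /mark; case: (m =P 0) => // ->.
apply: (@seg_trans _ _ _ _ (cf3 LimitT 0 X zero (fun m => X m.+1))); last first.
  apply: (@step3 _ _ _ _ _ _ (X 0) false (X 1) false) => //; by move=> m; case: eqP => // ->.
(* [Z n] is the output tape after [n] rounds; the bound [P n] fixes the cells already copied. *)
pose Z n m := if m < n then X m.+1 else false.
pose P n (t : 'I_3) m b := of3 (b = X m) (b = false) (m < n -> b = X m.+1) t.
have PA n t m : P n t m (of3 X zero (Z n) t m).
  by case: t => [[|[|[|//]]] l] //=; rewrite /P /of3 /= /Z => ->.
have Z0 : zero = Z 0 by apply: functional_extensionality.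
rewrite {2}Z0.
apply: (@seg_omega _ copy_machine (fun n => cf3 Copy n.+1 X zero (Z n)) P) => //.
  move=> n; apply: (@seg_trans _ _ _ _ (cf3 (CopyWrite (X n.+1)) n X zero (Z n))).
    apply: (@step3 _ _ _ _ _ _ (X n.+1) false (Z n n.+1) false) => //; by move=> m; case: eqP => // ->.
  apply: (@seg_trans _ _ _ _ (cf3 CopyNext n.+1 X zero (Z n.+1))).
    apply: (@step3 _ _ _ _ _ _ (X n) false (X n.+1) true) => // m; try by case: eqP => // ->.
    by rewrite /Z ltnS leq_eqVlt; case: eqP => [->|].
  apply: (@step3 _ _ _ _ _ _ (X n.+1) false (Z n.+1 n.+1) true) => //; try by move=> m; case: eqP => // ->.
  move=> t m; move: (PA n.+1 t m); rewrite /P.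
  by case: t => [[|[|[|//]]] l] //=; rewrite /of3 /= => H l'; apply: H; apply: ltnW.
case=> [[|[|[|//]]] l] m; rewrite /= /of3 /=.
- case E: (X m); first by move=> i; exists i.
  by exists 0 => n _; rewrite /P /of3 /= E.
- by exists 0 => n _; rewrite /P /of3.
case E: (X m.+1).
  by move=> i; exists (maxn i m.+1); [apply: leq_maxl|rewrite /Z leq_maxr].
by exists m.+1 => n ln; rewrite /P /of3 /= => H; move: E; rewrite -H.
Qed.

End ThreeTapes.

Theorem three_tapes_simulate (M : machine 1) a b :
  halts_with (copy_machine M) ord0 ord_max a b <->
  exists2 b', halts_with M ord0 ord0 a b' & b = (fun m => b' m.+1).
Proof.
pose phi (b : real) : real := fun m => b m.+1.
have tR (c : config 1 (nst M)) t n : tape (reg3 c) t n = mirror c (src3 t n).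
  by case: t => [[|[|[|//]]] l].
have tL (c : config 1 (nst M)) t n : tape (lim3 c) t n = mirror c (src3 t n).
  by case: t => [[|[|[|//]]] l].
split.
  apply: (simulate_halts_only (Ereg := @reg3 M) (Elim := @lim3 M) tR tL) => //.
  - exact: sim_step3.
  - exact: sim_limit3.
  - exact: sim_start3.
  - exact: sim_halt3.
move=> [b' + ->]; rewrite -/(phi b').
apply: (simulate_halts (Ereg := @reg3 M) (Elim := @lim3 M) tR tL) => //.
- exact: sim_step3.
- exact: sim_limit3.
- exact: sim_start3.
- exact: sim_halt3.
Qed.

(** Dropping the first bit undoes [cons1], so the two simulations give the two directions. *)
Theorem mainTheorem3 (f : real -> option real) :
  ittm_computable f <-> one_tape_computable (fun a => omap cons1 (f a)).
Proof.
split=> [] [M HM].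
  exists (pack_machine M) => a b; rewrite one_tape_simulates; split.
    by move=> [b' /HM -> ->].
  by case E: (f a) => [b'|] //= [<-]; exists b' => //; apply/HM.
exists (copy_machine M) => a b; rewrite three_tapes_simulate; split.
  by move=> [b' /HM]; case: (f a) => [g|] //= [<-] ->.
by move=> E; exists (cons1 b) => //; apply/HM; rewrite E.
Qed.
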